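(* Suppose that the generalized Cartan matrix $C$ is of infinite type. Then the inverse $\tilde C(q,t,\underline{\mu})=(\tilde C_{ij}(q,t,\underline{\mu}))_{i,j\in I}$ of the deformed generalized Cartan matrix $C(q,t,\underline{\mu})$ has non-negative coefficients, namely $\tilde C_{ij}(q,t,\underline{\mu})\in\mathbb{Z}_{\ge 0}[\Gamma_0][\![t]\!]$ for any $i,j\in I$.
   Context: Let $I$ be a finite set and $C=(c_{ij})_{i,j\in I}$ an irreducible symmetrizable generalized Cartan matrix (GCM): $c_{ii}=2$; $c_{ij}\in\mathbb{Z}_{\le 0}$ for $i\ne j$; $c_{ij}=0$ iff $c_{ji}=0$; there is $D=\mathrm{diag}(d_i\mid i\in I)$ with $d_i\in\mathbb{Z}_{>0}$ such that $DC$ is symmetric (a symmetrizer; fixed); and, writing $i\sim j$ when $c_{ij}<0$, any two elements of $I$ are connected by a chain of $\sim$. $C$ is of finite type if it is positive definite, and of infinite type otherwise. For $i\sim j$ put $g_{ij}=\gcd(|c_{ij}|,|c_{ji}|)$ and $f_{ij}=|c_{ij}|/g_{ij}$. $\Gamma$ is the multiplicative abelian group generated by $q,t$ and $\mu_{ij}^{(g)}$ ($i,j\in I$, $i\sim j$, $1\le g\le g_{ij}$) with relations $\mu_{ij}^{(g)}\mu_{ji}^{(g)}=1$; it is free abelian of finite rank. $\Gamma_0\subset\Gamma$ is the subgroup generated by $q$ and all $\mu_{ij}^{(g)}$, so $\Gamma=t^{\mathbb{Z}}\times\Gamma_0$ and $\mathbb{Z}[\Gamma]=\mathbb{Z}[\Gamma_0][t^{\pm1}]$.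 $\mathbb{Z}_{\ge 0}[\Gamma_0]$ is the set of elements of the group ring with non-negative coefficients, and $\mathbb{Z}_{\ge 0}[\Gamma_0][\![t]\!]$ the set of formal power series in $t$ with coefficients in it. With $[k]_q=(q^k-q^{-k})/(q-q^{-1})$, the deformed GCM $C(q,t,\underline{\mu})$ is the $\mathbb{Z}[\Gamma]$-valued $I\times I$ matrix with entries $$C_{ij}(q,t,\underline{\mu})=\begin{cases}q^{d_i}t^{-1}+q^{-d_i}t & i=j,\\ -[f_{ij}]_{q^{d_i}}\sum_{g=1}^{g_{ij}}\mu_{ij}^{(g)} & c_{ij}<0,\\ 0&\text{otherwise.}\end{cases}$$ It is invertible over $\mathbb{Z}[\Gamma_0](\!(t)\!)$, and $\tilde C(q,t,\underline{\mu})$ denotes its inverse there. *)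

(* Defs.v *)
From HB Require Import structures.
From mathcomp Require Import all_boot all_order perm all_algebra finmap.
From mathcomp Require Import boolp classical_sets functions fsbigop reals.
From mathcomp Require Import monalg ring zify.

Set Implicit Arguments.
Unset Strict Implicit.
Unset Printing Implicit Defensive.

Import Order.TTheory GRing.Theory Num.Theory.
Local Open Scope ring_scope.

Section Cartan.
Variables (n : nat) (C : 'M[int]_n) (d : 'I_n -> nat).

Definition gcm : Prop :=
  [/\ forall i, C i i = 2,
      forall i j, i != j -> C i j <= 0
    & forall i j, C i j = 0 <-> C j i = 0].

Definition dC : 'M[int]_n := diag_mx (\row_i (d i)%:Z) *m C.

Definition symmetrizer : Prop := (forall i, (0 < d i)%N) /\ dC^T = dC.

Definition adj : rel 'I_n := [rel i j | C i j < 0].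

Definition gcm_irreducible : Prop := forall i j, connect adj i j.

(* C itself need not be symmetric: its positive definiteness is that of the
   symmetric matrix DC. *)
Definition finite_type (R : realType) : Prop :=
  forall x : 'cV[R]_n, x != 0 -> 0 < (x^T *m map_mx intr dC *m x) 0 0.

(* The value 0 off the edges makes 'I_(edge_gcd i j), which indexes the
   generators mu_ij^(g), empty there; note that gcd(c_ii, c_ii) = 2. *)
Definition edge_gcd (i j : 'I_n) : nat :=
  if adj i j then gcdn `|C i j| `|C j i| else 0%N.

Definition edge_f (i j : 'I_n) : nat := (`|C i j| %/ edge_gcd i j)%N.

End Cartan.

Section Gamma0.
Variables (n : nat) (C : 'M[int]_n).

Definition mu_gen : finType :=
  {ij : 'I_n * 'I_n & 'I_(edge_gcd C ij.1 ij.2)}.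

(* The pairs formed of mu_ij^(g) and mu_ji^(g). *)
Definition opposite (a b : mu_gen) : bool :=
  [&& (tag a).1 == (tag b).2, (tag a).2 == (tag b).1
    & val (tagged a) == val (tagged b)].

(* The free abelian group on q (the generator None) and the mu_ij^(g). *)
Definition free_gens : zmodType := {ffun option mu_gen -> int}.

Definition free_gen (a : option mu_gen) : free_gens :=
  [ffun b => (a == b)%:R].

(* The subgroup generated by the relators mu_ij^(g) mu_ji^(g). *)
Definition relators : {pred free_gens} := fun x =>
  `[< exists m : mu_gen * mu_gen -> int,
        x = \sum_(p | opposite p.1 p.2)
              (free_gen (Some p.1) + free_gen (Some p.2)) *~ m p >].

Fact relators_zmod_closed : zmod_closed relators.
Proof.
split=> [|x y /asboolP[m ->] /asboolP[m' ->]]; apply/asboolP.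
  by exists (fun=> 0); rewrite big1.
exists (fun p => m p - m' p); rewrite -sumrB.
by apply: eq_bigr => p _; rewrite mulrzBr.
Qed.

HB.instance Definition _ :=
  GRing.isZmodClosed.Build free_gens relators relators_zmod_closed.

(* The group Gamma_0, written additively. *)
Definition Gamma0 : zmodType := Quotient.quot relators.

Definition gamma_q : Gamma0 := \pi_(Gamma0)%qT (free_gen None).

Definition mu_edge (i j : 'I_n) (g : 'I_(edge_gcd C i j)) : mu_gen :=
  Tagged (fun ij => 'I_(edge_gcd C ij.1 ij.2)) (i := (i, j)) g.

Definition gamma_mu (i j : 'I_n) (g : 'I_(edge_gcd C i j)) : Gamma0 :=
  \pi_(Gamma0)%qT (free_gen (Some (mu_edge g))).

End Gamma0.

Lemma gamma_muN n (C : 'M[int]_n) i j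
    (g : 'I_(edge_gcd C i j)) (h : 'I_(edge_gcd C j i)) :
  val g = val h -> gamma_mu g + gamma_mu h = 0.
Proof.
move=> gh; rewrite /gamma_mu -pi_addr.
have <- : \pi_(Gamma0 C)%qT 0 = 0 by rewrite pi_zeror.
apply/eqP; rewrite -Quotient.idealrBE subr0; apply/asboolP.
set a := mu_edge g; set b := mu_edge h.
exists (fun p => (p == (a, b))%:R); rewrite (bigD1 (a, b)) /=; last first.
  by rewrite /opposite !eqxx; apply/eqP.
rewrite eqxx mulr1z big1 ?addr0// => p /andP[_ /negbTE ->].
by rewrite mulr0z.
Qed.

(* The group ring Z[G] of an additively written abelian group G. {malg int[G]}
   only provides the additive structure: its product in the library requires a
   monoid without nontrivial units. *)
Definition grpring (G : zmodType) : Type := {malg int[G]}.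

HB.instance Definition _ (G : zmodType) := GRing.Zmodule.on (grpring G).

(* The element of Z[G] given by x; see geltD. *)
Definition gelt (G : zmodType) (x : G) : grpring G := << x >>.

Section GroupRing.
Variable G : zmodType.
Implicit Types (a b : grpring G) (x y : G).
Local Open Scope fset_scope.
Local Open Scope ring_scope.

Definition gmul a b : grpring G :=
  \sum_(x <- msupp a) \sum_(y <- msupp b) << a@_x * b@_y *g x + y >>.

Lemma gmulw (d1 d2 : {fset G}) a b : msupp a `<=` d1 -> msupp b `<=` d2 ->
  gmul a b = \sum_(x <- d1) \sum_(y <- d2) << a@_x * b@_y *g x + y >>.
Proof.
move=> le1 le2; rewrite /gmul (big_fset_incl _ le1) /=.
  apply: eq_bigr => x _; apply: (big_fset_incl _ le2) => y _ /mcoeff_outdom ->.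
  by rewrite mulr0 monalgU0.
move=> x _ /mcoeff_outdom ax.
by rewrite big1 // => y _; rewrite ax mul0r monalgU0.
Qed.

Lemma gmulC : commutative gmul.
Proof.
move=> a b; rewrite /gmul exchange_big; apply: eq_bigr => y _.
by apply: eq_bigr => x _; rewrite mulrC addrC.
Qed.

Lemma gmulDl : left_distributive gmul +%R.
Proof.
move=> a b c; set d := msupp a `|` msupp b.
have la : msupp a `<=` d by apply: fsubsetUl.
have lb : msupp b `<=` d by apply: fsubsetUr.
have lab : msupp (a + b) `<=` d by apply: msuppD_le.
rewrite !(@gmulw d (msupp c)) ?fsubset_refl // -big_split; apply: eq_bigr => x _.
rewrite -big_split; apply: eq_bigr => y _.
by rewrite mcoeffD mulrDl monalgUD.
Qed.

Lemma gmul0 : left_zero 0 gmul.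
Proof. by move=> a; rewrite /gmul msupp0 big_seq_fset0. Qed.

Lemma gmulUU (m k : int) x y :
  gmul << m *g x >> << k *g y >> = << (m * k) *g (x + y) >>.
Proof.
by rewrite (@gmulw [fset x] [fset y]) ?msuppU_le // !big_seq_fset1 !mcoeffUU.
Qed.

Lemma gmul_suml (I : Type) (r : seq I) (F : I -> grpring G) b :
  gmul (\sum_(i <- r) F i) b = \sum_(i <- r) gmul (F i) b.
Proof.
exact: (big_morph (gmul^~ b) (fun _ _ => gmulDl _ _ _) (gmul0 _)).
Qed.

Lemma gmul_sumr (I : Type) (r : seq I) (F : I -> grpring G) b :
  gmul b (\sum_(i <- r) F i) = \sum_(i <- r) gmul b (F i).
Proof. by rewrite gmulC gmul_suml; apply: eq_bigr => i _; rewrite gmulC. Qed.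

Lemma gmulA : associative gmul.
Proof.
move: gmul gmulUU gmul_suml gmul_sumr => mul mulUU suml sumr a b c.
rewrite [a]monalgE !suml; apply: eq_bigr => x _.
rewrite [b]monalgE !(suml, sumr); apply: eq_bigr => y _.
rewrite [c]monalgE !sumr; apply: eq_bigr => z _.
by rewrite !mulUU mulrA addrA.
Qed.

Lemma gmul1 : left_id (gelt 0) gmul.
Proof.
move=> a; rewrite [a in LHS]monalgE gmul_sumr [RHS]monalgE.
by apply: eq_bigr => x _; rewrite gmulUU mul1r add0r.
Qed.

Lemma gelt0_neq0 : gelt (0 : G) != 0.
Proof. by rewrite monalgU_eq0. Qed.

HB.instance Definition _ := GRing.Zmodule_isComNzRing.Build (grpring G)
  gmulA gmulC gmul1 gmulDl gelt0_neq0.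

Lemma geltD x y : gelt (x + y) = gelt x * gelt y.
Proof. by rewrite [RHS]gmulUU mulr1. Qed.

Lemma gelt0 : gelt (0 : G) = 1.
Proof. by []. Qed.

Lemma geltNr x : gelt x * gelt (- x) = 1.
Proof. by rewrite -geltD subrr. Qed.

(* [k]_v = v^(k-1) + v^(k-3) + ... + v^(1-k) for v = gelt x; v - v^-1 is not
   invertible in Z[G], and qintE is the usual expression as a quotient. *)
Definition qint x (k : nat) : grpring G :=
  \sum_(r < k) gelt (x *~ (k%:Z - 1 - r.*2%:Z)).

Lemma qintE x k :
  (gelt x - gelt (- x)) * qint x k = gelt (x *+ k) - gelt (- (x *+ k)).
Proof.
pose F r := gelt (x *~ (k%:Z - (r.*2)%:Z)).
rewrite /qint mulr_sumr.
rewrite (eq_bigr (fun r : 'I_k => F r - F r.+1)); last first.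
  move=> r _; rewrite mulrBl -!geltD /F doubleS.
  have -> e : x + x *~ e = x *~ (1 + e) by rewrite mulrzDr mulr1z.
  have -> e : - x + x *~ e = x *~ (-1 + e) by rewrite mulrzDr mulrN1z.
  by congr (gelt (x *~ _) - gelt (x *~ _)); rewrite ?intS; ring.
rewrite -(big_mkord xpredT (fun r => F r - F r.+1)).
rewrite (eq_bigr (fun r => - (F r.+1 - F r))) => [|r _]; last by rewrite opprB.
rewrite sumrN telescope_sumr // opprB /F subr0.
rewrite -[x *+ k]/(x *~ k%:Z) -mulrNz; congr (gelt _ - gelt (_ *~ _)).
by rewrite -addnn PoszD; ring.
Qed.

End GroupRing.

Section LaurentDef.
Variable A : comNzRingType.

Definition bounded_below : {pred int -> A} := fun f =>
  `[< exists N : int, forall k, k < N -> f k = 0 >].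

Fact bounded_below_zmod_closed : zmod_closed bounded_below.
Proof.
split=> [|f g /asboolP[N fN] /asboolP[M gM]]; apply/asboolP.
  by exists 0 => k _.
exists (Num.min N M) => k; rewrite lt_min => /andP[kN kM].
by rewrite -[LHS]/(f k - g k) fN ?gM ?subr0.
Qed.

HB.instance Definition _ :=
  GRing.isZmodClosed.Build (int -> A) bounded_below bounded_below_zmod_closed.

(* The ring A((t)) of formal Laurent series. *)
Record laurent := Laurent {
  lcoef :> int -> A;
  lcoef_bounded : lcoef \in bounded_below }.

HB.instance Definition _ := [isSub for lcoef].
HB.instance Definition _ := [Choice of laurent by <:].
HB.instance Definition _ := [SubChoice_isSubZmodule of laurent by <:].

Implicit Types f g h : laurent.

Lemma laurentP f g : (forall k, f k = g k) -> f = g.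
Proof. by move=> fg; apply: val_inj; apply/funext. Qed.

Lemma lcoefD f g k : (f + g) k = f k + g k.
Proof. by []. Qed.

Lemma lcoef_sum (I : Type) (r : seq I) (P : pred I) (F : I -> laurent) k :
  (\sum_(i <- r | P i) F i) k = \sum_(i <- r | P i) F i k.
Proof. by elim/big_rec2: _ => // i x y _ <-. Qed.

Lemma lboundP f : exists N : int, forall k, k < N -> f k = 0.
Proof. by case: f => f /= /asboolP. Qed.

(* The sum over k in Z has finite support. *)
Definition lmul_fun f g : int -> A :=
  fun m => \sum_(k \in @setT int) f k * g (m - k).

Definition tpoly f (N : int) (m : nat) : {poly A} := \poly_(i < m.+1) f (N + i%:Z).

Lemma lmul_funE f g (a b : int) (m : nat) :
  (forall k, k < a -> f k = 0) -> (forall k, k < b -> g k = 0) ->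
  lmul_fun f g (a + b + m%:Z) = (tpoly f a m * tpoly g b m)`_m.
Proof.
move=> fa gb; rewrite coefM /lmul_fun.
rewrite (fsbigTE [fset (a + i%:Z)%R | i in index_iota 0 m.+1]%fset); last first.
  move=> k kNi; have [ka|ak] := ltP k a; first by rewrite fa ?mul0r.
  have [mk|km] := ltP (a + m%:Z) k.
    by rewrite gb ?mulr0//; move: mk; rewrite !ltrBDr; lia.
  case/negP: kNi; apply/imfsetP; exists `|k - a|%N => /=; last by lia.
  by rewrite mem_index_iota; lia.
rewrite big_imfset; last by move=> i j _ _ /addrI [].
rewrite [LHS](_ : _ = \sum_(0 <= i < m.+1) f (a + i%:Z) * g (a + b + m%:Z - (a + i%:Z))); last first.
  rewrite (_ : enum_finmem _ = undup (index_iota 0 m.+1)) //.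
  by rewrite undup_id ?iota_uniq.
rewrite big_mkord; apply: eq_bigr => i _; rewrite !coef_poly ltn_ord ltnS leq_subr.
by congr (_ * g _); have := ltn_ord i; lia.
Qed.

Lemma lmul_fun0 f g (a b k : int) :
  (forall k, k < a -> f k = 0) -> (forall k, k < b -> g k = 0) ->
  k < a + b -> lmul_fun f g k = 0.
Proof.
move=> fa gb kab; apply: fsbig1 => i _.
have [ia|ai] := ltP i a; first by rewrite fa ?mul0r.
by rewrite gb ?mulr0//; lia.
Qed.

Fact lmul_bounded f g : lmul_fun f g \in bounded_below.
Proof.
have [a fa] := lboundP f; have [b gb] := lboundP g.
by apply/asboolP; exists (a + b) => k; apply: lmul_fun0.
Qed.

Definition lmul f g : laurent := Laurent (lmul_bounded f g).

(* The monomial a t^m *)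
Definition lmon_fun (a : A) (m k : int) : A := if k == m then a else 0.

Fact lmon_bounded a m : lmon_fun a m \in bounded_below.
Proof.
by apply/asboolP; exists m => k km; rewrite /lmon_fun; case: eqP km => // ->; lia.
Qed.

Definition lmon a m : laurent := Laurent (lmon_bounded a m).

Lemma lmulC : commutative lmul.
Proof.
move=> f g; have [a fa] := lboundP f; have [b gb] := lboundP g.
apply: laurentP => k /=.
have [kab|abk] := ltP k (a + b).
  by rewrite (@lmul_fun0 _ _ a b) ?(@lmul_fun0 _ _ b a) // addrC.
have -> : k = a + b + (absz (k - (a + b))%R)%:Z by lia.
by rewrite lmul_funE // mulrC -lmul_funE // [b + a]addrC.
Qed.

Lemma lmulDl : left_distributive lmul +%R.
Proof.
move=> f g h; have [a fa] := lboundP f; have [b gb] := lboundP g.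
have [c hc] := lboundP h; apply: laurentP => k; rewrite lcoefD /=.
set N := Num.min a b.
have fN i : i < N -> f i = 0 by rewrite lt_min => /andP[/fa].
have gN i : i < N -> g i = 0 by rewrite lt_min => /andP[_ /gb].
have fgN i : i < N -> (f + g) i = 0 by move=> iN; rewrite lcoefD fN ?gN ?addr0.
have [kN|Nk] := ltP k (N + c).
  by rewrite !(@lmul_fun0 _ _ N c) ?addr0.
have -> : k = N + c + (absz (k - (N + c))%R)%:Z by lia.
rewrite !lmul_funE // -coefD -mulrDl; congr (nth 0 (polyseq (_ * _)) _).
by apply/polyP => i; rewrite coefD !coef_poly; case: ifP; rewrite ?addr0.
Qed.

Lemma lmulA : associative lmul.
Proof.
move=> f g h; have [a fa] := lboundP f; have [b gb] := lboundP g.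
have [c hc] := lboundP h; apply: laurentP => k /=.
have fg0 i : i < a + b -> lmul f g i = 0 by apply: lmul_fun0.
have gh0 i : i < b + c -> lmul g h i = 0 by apply: lmul_fun0.
have [kN|Nk] := ltP k (a + b + c).
  by rewrite (@lmul_fun0 _ _ a (b + c)) ?(@lmul_fun0 _ _ (a + b) c) // addrA.
have -> : k = a + b + c + (absz (k - (a + b + c))%R)%:Z by lia.
set m := absz _; rewrite [RHS]lmul_funE // -[in LHS](addrA a b c) [LHS]lmul_funE //.
have tr N1 N2 (u v : laurent) i : (forall k, k < N1 -> u k = 0) ->
    (forall k, k < N2 -> v k = 0) -> (i <= m)%N ->
    (tpoly (lmul u v) (N1 + N2) m)`_i = (tpoly u N1 m * tpoly v N2 m)`_i.
  move=> u0 v0 im; rewrite coef_poly ltnS im /= lmul_funE // !coefM.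
  apply: eq_bigr => j _; have := ltn_ord j; rewrite ltnS => ji.
  by rewrite !coef_poly !ltnS ji leq_subr (leq_trans ji im)
    (leq_trans (leq_subr _ _) im).
have -> : (tpoly f a m * tpoly (lmul g h) (b + c) m)`_m
    = (tpoly f a m * (tpoly g b m * tpoly h c m))`_m.
  rewrite coefM [RHS]coefM; apply: eq_bigr => j _.
  by rewrite tr // leq_subr.
rewrite mulrA coefM [RHS]coefM; apply: eq_bigr => j _.
by rewrite tr // -ltnS.
Qed.

Lemma lmul_lmon (a : A) (m : int) f k : (lmul (lmon a m) f) k = a * f (k - m).
Proof.
rewrite /= /lmul_fun (fsbigTE [fset m]%fset); last first.
  by move=> i; rewrite inE => /negbTE im; rewrite /= /lmon_fun im mul0r.
by rewrite big_seq_fset1 /= /lmon_fun eqxx.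
Qed.

Lemma lmul1 : left_id (lmon 1 0) lmul.
Proof. by move=> f; apply: laurentP => k; rewrite lmul_lmon mul1r subr0. Qed.

Lemma lmon1_neq0 : lmon 1 0 != 0.
Proof.
apply/eqP => /(congr1 (fun f : laurent => f 0)) /=; rewrite /lmon_fun eqxx.
by apply/eqP; exact: oner_neq0.
Qed.

HB.instance Definition _ := GRing.Zmodule_isComNzRing.Build laurent
  lmulA lmulC lmul1 lmulDl lmon1_neq0.

(* linv is the identity on non-units; dgcm_unit shows that the deformed matrix
   is invertible. *)
Definition lunit : {pred laurent} := fun f => `[< exists g, g * f = 1 >].

Definition linv f : laurent :=
  if pselect (exists g, g * f = 1) is left e then sval (cid e) else f.

Fact lmulVf : {in lunit, left_inverse 1 linv *%R}.
Proof.
move=> f /asboolP uf; rewrite /linv; case: pselect => // e.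
exact: svalP (cid e).
Qed.

Fact lunitPl f g : g * f = 1 -> f \in lunit.
Proof. by move=> gf; apply/asboolP; exists g. Qed.

Fact linv_out : {in [predC lunit], linv =1 id}.
Proof.
by move=> f /negP uf; rewrite /linv; case: pselect => // e; case: uf; apply/asboolP.
Qed.

HB.instance Definition _ := GRing.ComNzRing_hasMulInverse.Build laurent
  lmulVf lunitPl linv_out.

Lemma lmonM (a b : A) (m k : int) : lmon a m * lmon b k = lmon (a * b) (m + k).
Proof.
apply: laurentP => i; rewrite lmul_lmon /= /lmon_fun subr_eq addrC.
by case: eqP; rewrite ?mulr0.
Qed.

Lemma lmon1 : lmon 1 0 = 1.
Proof. by []. Qed.

End LaurentDef.

Section LaurentUnit.
Variable A : comNzRingType.
Implicit Types f g h : laurent A.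

Lemma lcoefM f g m : (f * g) m = \sum_(k \in @setT int) f k * g (m - k).
Proof. by []. Qed.

Lemma lcoefM0 f g (a b k : int) :
  (forall k, k < a -> f k = 0) -> (forall k, k < b -> g k = 0) ->
  k < a + b -> (f * g) k = 0.
Proof. exact: lmul_fun0. Qed.

Lemma lcoef1 k : (1 : laurent A) k = (k == 0)%:R.
Proof. by rewrite -lmon1 /= /lmon_fun; case: eqP. Qed.

Definition power_series f := forall k, k < 0 -> f k = 0.

Lemma power_series1 : power_series 1.
Proof. by move=> k k0; rewrite lcoef1; case: eqP k0 => // ->; lia. Qed.

Lemma power_seriesM f g : power_series f -> power_series g ->
  power_series (f * g) /\ (f * g) 0 = f 0 * g 0.
Proof.
move=> f0 g0; split=> [k k0|]; first exact: (lcoefM0 f0 g0).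
rewrite -[LHS]/(lmul_fun f g (0 + 0 + 0%:Z)) lmul_funE //.
by rewrite coefM big_ord1 !coef_poly.
Qed.

Lemma lunit_power_series f : power_series f -> f 0 = 1 -> f \is a GRing.unit.
Proof.
move=> f0 f1; pose x := 1 - f.
have x0 k : k < 1 -> x k = 0.
  move=> k1; rewrite -[x k]/((1 : laurent A) k - f k) lcoef1.
  have [->|kn0] := eqVneq k 0; first by rewrite f1 subrr.
  by rewrite f0 ?subrr //; lia.
have xn0 n k : k < n%:Z -> (x ^+ n) k = 0.
  elim: n k => [|n IHn] k kn; first exact: power_series1.
  by rewrite exprS; apply: (@lcoefM0 _ _ 1 n%:Z) => //; lia.
pose S n : laurent A := \sum_(j < n) x ^+ j.
have fS n : f * S n = 1 - x ^+ n.
  by rewrite -opprB subrX1 -mulNr opprB /x opprB addrC subrK.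
have Sle (n m : nat) (k : int) : (n <= m)%N -> k < n%:Z -> S n k = S m k.
  move=> nm kn; rewrite /S -!(big_mkord xpredT (fun j => x ^+ j)).
  rewrite (big_cat_nat (leq0n n) nm) lcoefD [X in _ + X]lcoef_sum.
  rewrite [X in _ + X]big_nat_cond [X in _ + X]big1 ?addr0 // => i /andP[/andP[ni _] _].
  by apply: xn0; lia.
pose hf (k : int) : A := if k < 0 then 0 else S (absz k).+1 k.
have hb : hf \in @bounded_below A.
  by apply/asboolP; exists 0 => k k0; rewrite /hf k0.
pose h := Laurent hb.
suff fh : f * h = 1 by apply/asboolP; exists h; rewrite mulrC.
apply: laurentP => k; have [k0|k0] := ltP k 0.
  rewrite power_series1 //; apply: (@lcoefM0 _ _ 0 0) => // i i0.
  by rewrite /= /hf i0.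
transitivity ((f * S (absz k).+1) k).
  rewrite !lcoefM; apply: eq_fsbigr => i _.
  have [i0|i0] := ltP i 0; first by rewrite f0 ?mul0r.
  congr (_ * _); rewrite /= /hf; case: ltP => ki.
    rewrite lcoef_sum big1 // => j _; apply: xn0; lia.
  by apply: Sle; lia.
by rewrite fS -[LHS]/((1 : laurent A) k - (x ^+ _) k) xn0 ?subr0 //; lia.
Qed.

Lemma power_series_det n (M : 'M[laurent A]_n) :
  (forall i j, power_series (M i j)) ->
  power_series (\det M) /\ (\det M) 0 = \det (\matrix_(i, j) M i j 0).
Proof.
move=> M0.
have prodM (s : 'S_n) : power_series (\prod_i M i (s i)) /\
    (\prod_i M i (s i)) 0 = \prod_i M i (s i) 0.
  elim/big_rec2: _ => [|i y z _ [y0 yz]].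
    by split; [exact: power_series1 | rewrite lcoef1].
  by have [? ->] := power_seriesM (M0 i (s i)) y0; rewrite yz.
have sgn (b : bool) (u : laurent A) k : ((-1) ^+ b * u) k = (-1) ^+ b * u k.
  by case: b; rewrite ?mul1r // expr1 !mulN1r.
split=> [k k0|]; rewrite /determinant lcoef_sum.
  by rewrite big1 // => s _; rewrite sgn (prodM s).1 ?mulr0.
apply: eq_bigr => s _; rewrite sgn (prodM s).2; congr (_ * _).
by apply: eq_bigr => i _; rewrite mxE.
Qed.

Lemma lmon_unit (a b : A) m : a * b = 1 -> lmon a m \is a GRing.unit.
Proof.
by move=> ab; apply/asboolP; exists (lmon b (- m)); rewrite lmonM addNr mulrC ab.
Qed.

End LaurentUnit.

Section Deformed.
Variables (n : nat) (C : 'M[int]_n) (d : 'I_n -> nat).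

Let q : Gamma0 C := gamma_q C.

(* Entries in Z[Gamma_0]((t)), which contains Z[Gamma] = Z[Gamma_0][t, t^-1]. *)
Definition dgcm : 'M[laurent (grpring (Gamma0 C))]_n :=
  \matrix_(i, j)
    if i == j then lmon (gelt (q *+ d i)) (-1) + lmon (gelt (- (q *+ d i))) 1
    else if adj C i j then
      - lmon (qint (q *+ d i) (edge_f C i j)
              * \sum_(g < edge_gcd C i j) gelt (gamma_mu g)) 0
    else 0.

Lemma dgcm_unit : dgcm \in unitmx.
Proof.
pose e i : laurent (grpring (Gamma0 C)) := lmon (gelt (- (q *+ d i))) 1.
pose P := diag_mx (\row_i e i) *m dgcm.
have PE i j : P i j = e i * dgcm i j by rewrite /P mul_diag_mx !mxE.
have Pcoef i j k : P i j k = gelt (- (q *+ d i)) * dgcm i j (k - 1).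
  by rewrite PE; apply: lmul_lmon.
have Dlow i j k : k < 0 -> dgcm i j k = (i == j)%:R * gelt (q *+ d i) * (k == -1)%:R.
  move=> k0; rewrite mxE; case: eqP => [_|_].
    rewrite lcoefD /= /lmon_fun mul1r.
    have /negbTE -> : k != 1 by apply/eqP; lia.
    by rewrite addr0; case: eqP; rewrite ?mulr1 ?mulr0.
  rewrite !mul0r; case: ifP => // _.
  rewrite -[LHS]/(- (lmon_fun _ 0 k)) /lmon_fun.
  by rewrite ifN ?oppr0 // lt_eqF.
have P0 i j : power_series (P i j).
  move=> k k0; rewrite Pcoef Dlow; last by lia.
  have /negbTE -> : k - 1 != -1 by apply/eqP; lia.
  by rewrite !mulr0.
have [detP0] := power_series_det P0.
rewrite [X in _ = \det X](_ : _ = 1%:M) => [detP1|].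
  have := lunit_power_series detP0; rewrite detP1 det1 => /(_ erefl).
  by rewrite det_mulmx unitrM unitmxE => /andP[].
apply/matrixP => i j; rewrite mxE Pcoef Dlow // sub0r eqxx mulr1 [RHS]mxE.
by case: eqP => _; rewrite ?mul1r ?mul0r ?mulr0 // mulrC geltNr.
Qed.

End Deformed.

(* f is in Z_{>=0}[G][[t]]. *)
Definition nonneg_power_series (G : zmodType) (f : laurent (grpring G)) : Prop :=
  power_series f /\ forall (k : int) (x : G), 0 <= (f k)@_x.

(* Main.v *)
(** Let [p_i = q^(-d_i)] and [b_ij = - p_i C_ij(q, mu)] for [i <> j]. Up to the
    factor [p_j], the coefficient of [t^(m+1)] in the (k, j) entry of the inverse
    is [K_m(k, j)], where [K_(-1) = 0], [K_0 = 1] and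
    [K_(m+2)(k, j) = sum_i K_(m+1)(k, i) b_ij - p_j^2 K_m(k, j)].
    This is the recursion satisfied by the "roots" [T_(i_1) ... T_(i_r) alpha_j]
    for the q-deformed reflections [T_i] of the bipartite double cover of [C],
    along the word that fires alternately all the vertices of either colour.
    By the argument of Deodhar, which rests on the braid relations and on an
    explicit calculation in rank two, such a root has only non-negative or only
    non-positive coefficients as long as all the previous ones are non-negative.
    The second alternative is excluded in infinite type: there is then a nonzero
    [u >= 0] with [u C <= 0], so that for [q = mu = 1] the numbers [(u K_m)_j]
    form a convex increasing sequence, hence remain positive. *)
Require Import Defs.
From mathcomp Require Import all_boot all_order all_algebra reals.
From HB Require Import structures.
From mathcomp Require Import finmap boolp monalg ring lra zify.

Set Implicit Arguments.
Unset Strict Implicit.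
Unset Printing Implicit Defensive.

Import Order.TTheory GRing.Theory Num.Theory.
Local Open Scope ring_scope.

(** * Sign coherence of roots for deformed reflections *)

(** An abstract notion of non-negativity for coefficients. Pointedness is what prevents a nonzero
    vector from being both positive and negative. *)
Record cone (S : comNzRingType) (P : S -> Prop) : Prop := Cone {
  cone1 : P 1;
  coneD : forall x y, P x -> P y -> P (x + y);
  coneM : forall x y, P x -> P y -> P (x * y);
  cone_pointed : forall x, P x -> P (- x) -> x = 0;
  cone0 : P 0 }.

Section Reflections.
Variables (S : comNzRingType) (P : S -> Prop) (J : finType).
Variables (p : J -> S) (b : J -> J -> S).
Hypothesis P_cone : cone P.
Hypothesis p_pos : forall i, P (p i).
Hypothesis p_reg : forall i x, p i * x = 0 -> x = 0.
Hypothesis b_pos : forall i j, P (b i j).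
Implicit Types (i j k l : J) (v : J -> S) (w : seq J).

Definition simple i : J -> S := fun k => (k == i)%:R.

Lemma simpleE i k : simple i k = (k == i)%:R.
Proof. by []. Qed.

(* At p i = 1 this is the simple reflection for the Cartan matrix 2 - b. *)
Definition refl i v : J -> S := fun k =>
  if k == i then - (p i ^+ 2) * v i + \sum_(j | j != i) b i j * v j else v k.

Definition act w v : J -> S := foldr refl v w.

Definition pos v := forall k, P (v k).

Definition comb (x : S) v (y : S) v' : J -> S := fun k => x * v k + y * v' k.

Lemma refl_comb i x v y v' :
  refl i (comb x v y v') = comb x (refl i v) y (refl i v').
Proof.
apply/funext => k; rewrite /refl /comb; case: eqP => // _.
rewrite !mulrDr !mulr_sumr addrACA -big_split /=; congr (_ + _); first by ring.
by apply: eq_bigr => j _; ring.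
Qed.

Lemma act_comb w x v y v' :
  act w (comb x v y v') = comb x (act w v) y (act w v').
Proof. by elim: w => //= i w ->; rewrite refl_comb. Qed.

Lemma act_cat w w' v : act (w ++ w') v = act w (act w' v).
Proof. by rewrite /act foldr_cat. Qed.

Lemma act_rcons w i v : act (rcons w i) v = act w (refl i v).
Proof. by rewrite -cats1 act_cat. Qed.

Lemma act_scale w x v : act w (fun k => x * v k) = fun k => x * act w v k.
Proof.
have e u : (fun k => x * u k) = comb x u 0 u.
  by apply/funext => k; rewrite /comb mul0r addr0.
by rewrite !e act_comb.
Qed.

Lemma refl_simple i : refl i (simple i) = fun k => - (p i ^+ 2) * simple i k.
Proof.
apply/funext => k; rewrite /refl /simple eqxx big1; last first.
  by move=> j /negbTE ->; rewrite mulr0.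
by case: eqP => // _; rewrite ?addr0 ?mulr0.
Qed.

Lemma refl_simple_neq i j : i != j ->
  refl i (simple j) = comb 1 (simple j) (b i j) (simple i).
Proof.
move=> ij; apply/funext => k; rewrite /refl /comb /simple (negbTE ij) mulr0 add0r mul1r.
case: eqP => [->|_]; last by rewrite mulr0 addr0.
rewrite (negbTE ij) add0r mulr1 (bigD1 j) 1?eq_sym //= eqxx mulr1 big1 ?addr0 //.
by move=> l /andP[_ /negbTE ->]; rewrite mulr0.
Qed.

(** Once the other coordinates vanish, coordinate [i] is just multiplied by [- p i ^+ 2], which is
    regular. Hence roots never vanish. *)
Lemma refl_eq0 i v : refl i v = (fun=> 0) -> v = fun=> 0.
Proof.
move=> /funeqP v0; have vk k : k != i -> v k = 0.
  by move=> ki; have := v0 k; rewrite /refl (negbTE ki).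
apply/funext => k; have [->|/vk //] := eqVneq k i.
have := v0 i; rewrite /refl eqxx big1 ?addr0 => [|j /vk ->]; last by rewrite mulr0.
by rewrite mulNr => /eqP; rewrite oppr_eq0 expr2 -mulrA => /eqP /p_reg /p_reg.
Qed.

Lemma act_simple_neq0 w i : act w (simple i) <> fun=> 0.
Proof.
elim: w => [|j w IHw] /=; last by move/refl_eq0.
by move=> /funeqP /(_ i); rewrite /simple eqxx => /eqP; rewrite oner_eq0.
Qed.

(** This stands in for reducedness: each appended letter must be an ascent, expressed by the
    positivity of a root, so that no group or length function has to be introduced. *)
Inductive good : seq J -> Prop :=
| Good0 : good [::]
| GoodS w i : good w -> pos (act w (simple i)) -> good (rcons w i).

Lemma good_rcons w i : good (rcons w i) -> good w /\ pos (act w (simple i)).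
Proof.
move E : (rcons w i) => u gu; case: gu E => [|u' i' gu pu] E.
  by move: (congr1 size E); rewrite size_rcons.
by move: (rcons_inj E) => [-> ->].
Qed.

(** Whether a letter may be appended depends only on the operator of the word before it, so a prefix
    may be exchanged for a good one with the same action. *)
Lemma good_cat_act w1 w2 w :
  good w1 -> act w1 = act w2 -> good (w2 ++ w) -> good (w1 ++ w).
Proof.
move=> g1 e; elim/last_ind: w => [|w i IHw]; first by rewrite !cats0.
rewrite -!rcons_cat => /good_rcons[/IHw gw pw]; apply: GoodS => //.
by move: pw; rewrite !act_cat e.
Qed.

Lemma good_catl w1 w2 : good (w1 ++ w2) -> good w1.
Proof.
elim/last_ind: w2 => [|w i IHw]; first by rewrite cats0.
by rewrite -rcons_cat => /good_rcons[/IHw].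
Qed.

Lemma comb_pos x v y v' : P x -> P y -> pos v -> pos v' -> pos (comb x v y v').
Proof. by move=> *; move=> k; apply: coneD => //; apply: coneM. Qed.

Lemma p2_pos i : P (p i ^+ 2).
Proof. by rewrite expr2; apply: coneM. Qed.

Definition neg v := forall k, P (- v k).

Lemma pos_neg v : pos v -> neg v -> v = fun=> 0.
Proof. by move=> pv nv; apply/funext => k; apply: (cone_pointed P_cone). Qed.

Lemma act_rcons_simple w i : pos (act w (simple i)) -> neg (act (rcons w i) (simple i)).
Proof.
move=> pw k; rewrite act_rcons refl_simple act_scale mulNr opprK.
by apply: coneM => //; apply: p2_pos.
Qed.

(** * Alternating words and Deodhar's dichotomy *)

Fixpoint alt n i j : seq J := if n is n'.+1 then i :: alt n' j i else [::].

Definition alt_next n i j : J := if odd n then j else i.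

Lemma alt_nextS n i j : alt_next n.+1 i j = alt_next n j i.
Proof. by rewrite /alt_next /=; case: odd. Qed.

Lemma alt_rcons n i j : alt n.+1 i j = rcons (alt n i j) (alt_next n i j).
Proof.
elim: n i j => [|n IHn] i j //.
by rewrite -[alt n.+2 i j]/(i :: alt n.+1 j i) IHn alt_nextS.
Qed.

Lemma size_alt n i j : size (alt n i j) = n.
Proof. by elim: n i j => //= n IHn i j; rewrite IHn. Qed.

Lemma alt_prefix n m i j : (n <= m)%N -> exists w, alt m i j = alt n i j ++ w.
Proof.
elim: n m i j => [|n IHn] [|m] i j // nm; [by exists [::] | by exists (alt m.+1 i j) |].
by have [w ew] := IHn m j i nm; exists w; rewrite /= ew.
Qed.

(* The coefficients of rank-two roots in the simple roots, see act_alt. *)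
Fixpoint cheb n i j : S :=
  match n with
  | 0 => 1
  | n'.+1 => b i j * cheb n' j i -
      (if n' is n''.+1 then p i ^+ 2 * cheb n'' i j else 0)
  end.

Definition cheb_pred n i j : S := if n is n'.+1 then cheb n' i j else 0.

Lemma chebS n i j : cheb n.+1 i j = b i j * cheb n j i - p i ^+ 2 * cheb_pred n i j.
Proof. by case: n => [|n] //=; rewrite mulr0. Qed.

(** Removing the first letter exchanges [i] and [j]; applying its reflection then reproduces the
    recursion of [cheb]. *)
Lemma act_alt n i j : i != j ->
  act (alt n i j) (simple (alt_next n i j)) =
  comb (cheb n i j) (simple i) (cheb_pred n j i) (simple j).
Proof.
elim: n i j => [|n IHn] i j ij.
  by apply/funext => k; rewrite /comb /= mul1r mul0r addr0.
rewrite alt_nextS [alt _ _ _]/= [act _ _]/= -/(act _ _) IHn 1?eq_sym // refl_comb.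
rewrite refl_simple refl_simple_neq // chebS; apply/funext => k.
by rewrite /comb /=; ring.
Qed.

(** Either the infinite dihedral case, or the finite one with Coxeter exponent [m.+1]. *)
Definition dihedral i j :=
  (forall n, P (cheb n i j) /\ P (cheb n j i)) \/
  exists m, (forall n, (n < m.+1)%N -> P (cheb n i j) /\ P (cheb n j i)) /\
    act (alt m.+1 i j) = act (alt m.+1 j i).

Hypothesis rank2 : forall i j, i != j -> dihedral i j.

Lemma cheb_pred_pos m n i j :
  (forall n, (n < m)%N -> P (cheb n i j)) -> (n <= m)%N -> P (cheb_pred n i j).
Proof. by case: n => [|n] H nm; [exact: cone0 | exact: H]. Qed.

(** Each root to be tested is the image under [act w] of a rank-two root, hence a combination of two
    positive vectors with coefficients in the cone. *)
Lemma good_cat_alt w i j m n : i != j ->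
  (forall n, (n < m)%N -> P (cheb n i j) /\ P (cheb n j i)) ->
  good w -> pos (act w (simple i)) -> pos (act w (simple j)) ->
  (n <= m)%N -> good (w ++ alt n i j).
Proof.
move=> ij Pm gw wi wj; elim: n => [|n IHn] nm; first by rewrite cats0.
rewrite alt_rcons -rcons_cat; apply: GoodS; first by apply: IHn; apply: ltnW.
rewrite act_cat act_alt // act_comb; apply: comb_pos => //; first exact: (Pm _ nm).1.
by apply: (@cheb_pred_pos m) => [l /Pm[]|] //; apply: ltnW.
Qed.

(** The negative case carries an exchange condition, which lets the induction rewrite a word so that
    it ends in a prescribed descent. *)
Definition root_dichotomy w i :=
  pos (act w (simple i)) \/
  (neg (act w (simple i)) /\
   exists w', [/\ good (rcons w' i), size w = (size w').+1 & act w = act (rcons w' i)]).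

(** If [j] is a descent of [w], the induction hypothesis rewrites [w] as [w'] followed by [j], and
    this [j] joins the alternating word on its left. As [w] gets shorter, the process stops, with
    both letters ascents. The condition [0 < n] keeps [w] shorter than [N]. *)
Lemma peel N : (forall w i, (size w < N)%N -> good w -> root_dichotomy w i) ->
  forall w n i j, (0 < n)%N -> (size w + n)%N = N -> good (w ++ alt n i j) ->
  pos (act w (simple i)) -> i != j ->
  exists w' n' i' j', [/\ [/\ (0 < n')%N, (size w' + n')%N = N & i' != j'],
    act (w ++ alt n i j) = act (w' ++ alt n' i' j'), alt_next n i j = alt_next n' i' j',
    good (w' ++ alt n' i' j')
    & pos (act w' (simple i')) /\ pos (act w' (simple j'))].
Proof.
move=> IH w; have [s] := ubnP (size w).
elim: s w => // s IHs w sw n i j n0 wN gw wi ij.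
have gw' := good_catl gw.
have [|wj|[_ [w' [gw'j ww' ew]]]] := IH w j _ gw'; first by lia.
  by exists w, n, i, j; split.
have e : act (w ++ alt n i j) = act (w' ++ alt n.+1 j i).
  by apply/funext => v; rewrite act_cat ew act_rcons act_cat.
have [||||||w2 [n2 [i2 [j2 [H1 H2 H3 H4 H5]]]]] := IHs w' _ n.+1 j i;
  try by [lia|rewrite eq_sym].
- by rewrite -cat_rcons; apply: good_cat_act gw.
- by case: (good_rcons gw'j).
by exists w2, n2, i2, j2; split=> //; rewrite ?e // -H3 alt_nextS.
Qed.

(* Deodhar's argument: a word ending in j is split, up to the braid relations,
   as a word with i and j both ascents followed by an alternating word in i
   and j, which reduces the claim to rank two. *)
Lemma good_dichotomy w i : good w -> root_dichotomy w i.
Proof.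
have [N] := ubnP (size w); elim: N w i => // N IH w i; rewrite ltnS leq_eqVlt.
case/orP=> [/eqP wN|]; last exact: IH.
case/lastP: w wN => [|w1 j] wN gw.
  left=> k /=; rewrite /simple; case: eqP => _; [exact: cone1|exact: cone0].
have [gw1 w1j] := good_rcons gw.
have [<-|ji] := eqVneq j i.
  by right; split; [exact: act_rcons_simple | exists w1; rewrite size_rcons].
have IH' w' i' : (size w' < N)%N -> good w' -> root_dichotomy w' i' by exact: IH.
have e1 : alt 1%N j i = [:: j] by [].
(* The last letter [j] is the initial alternating word, of length one; peeling extends it to the
   left. *)
have [||w' [n [x [y [[n0 sN xy] e i_next gw' [w'x w'y]]]]]] :=
    @peel N IH' w1 1%N j i isT _ _ w1j ji.
- by rewrite -wN size_rcons addn1.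
- by rewrite e1 cats1.
move: e i_next; rewrite e1 cats1 => e.
rewrite [in X in X -> _]/alt_next /= -/(alt_next n x y) => i_next.
have gw'' := good_catl gw'.
have pos_lt : P (cheb n x y) -> P (cheb_pred n y x) -> root_dichotomy (rcons w1 j) i.
  move=> P1 P2; left; rewrite e i_next act_cat act_alt // act_comb.
  exact: comb_pos.
have [Pinf|[m [Pm braid]]] := rank2 xy.
  apply: pos_lt; first exact: (Pinf n).1.
  by apply: (@cheb_pred_pos n) => // l _; exact: (Pinf l).2.
have gyx (l : nat) : (l <= m.+1)%N -> good (w' ++ alt l y x).
  apply: good_cat_alt => //; first by rewrite eq_sym.
  by move=> l' /Pm[].
have ebraid : act (w' ++ alt m.+1 x y) = act (rcons (w' ++ alt m y x) (alt_next m y x)).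
  by apply/funext => v; rewrite act_cat braid -act_cat alt_rcons rcons_cat.
have [nm|mn|nm] := ltngtP n m.+1.
- apply: pos_lt; first exact: (Pm _ nm).1.
  by apply: (@cheb_pred_pos m.+1) => [l /Pm[]|] //; apply: ltnW.
(* Too long an alternating word is not good: after the braid relation its prefix of length [m.+1]
   ends in the very letter that comes next, so the root of that letter would be both positive and
   negative, hence zero. *)
- exfalso; have [u eu] := alt_prefix x y mn.
  have : good (w' ++ alt m.+2 x y) by apply: (@good_catl _ u); rewrite -catA -eu.
  rewrite alt_rcons -rcons_cat => /good_rcons[_]; rewrite ebraid alt_nextS => pw.
  have nw : neg (act (rcons (w' ++ alt m y x) (alt_next m y x)) (simple (alt_next m y x))).
    apply: act_rcons_simple.
    by have := gyx _ (leqnn _); rewrite alt_rcons -rcons_cat => /good_rcons[].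
  exact: act_simple_neq0 (pos_neg pw nw).
(* The alternating word is the longest one: the braid relation makes it end in [i], which yields
   both the sign and the exchanged word. *)
- have gi := gyx _ (leqnn _); move: gi e i_next.
  rewrite nm alt_nextS alt_rcons -rcons_cat ebraid => gi e i_next; rewrite -i_next in gi e.
  right; split; last first.
    exists (w' ++ alt m y x); split => //.
    by rewrite wN -sN nm size_cat size_alt addnS.
  by rewrite e; apply: act_rcons_simple; case: (good_rcons gi).
Qed.

(** * Braid relations and positivity in rank two *)

Definition put i j v x y : J -> S :=
  fun k => if k == i then x else if k == j then y else v k.

(** Words in [i] and [j] change only these two coordinates, and all others enter through this
    constant. Each braid relation thus becomes a polynomial identity in two coordinates. *)
Definition off i j v : S := \sum_(l | (l != i) && (l != j)) b i l * v l.

Lemma put_id i j v : v = put i j v (v i) (v j).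
Proof. by apply/funext => k; rewrite /put; case: eqP => [->|_] //; case: eqP => [->|]. Qed.

Lemma refl_putl i j v x y : i != j -> refl i (put i j v x y) =
  put i j v (- (p i ^+ 2) * x + b i j * y + off i j v) y.
Proof.
rewrite eq_sym => ji; apply/funext => k; rewrite /refl /put; case: eqP => // _.
rewrite eqxx -addrA; congr (_ + _); rewrite (bigD1 j) //=.
rewrite (negbTE ji) eqxx; congr (_ + _); apply: eq_bigr => l.
by case/andP=> /negbTE -> /negbTE ->.
Qed.

Lemma refl_putr i j v x y : i != j -> refl j (put i j v x y) =
  put i j v x (- (p j ^+ 2) * y + b j i * x + off j i v).
Proof.
move=> ij; have putC z z' : put i j v z z' = put j i v z' z.
  by apply/funext => k; rewrite /put; case: eqP => // ->; rewrite (negbTE ij).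
by rewrite !putC refl_putl // eq_sym.
Qed.

Lemma braid2 i j : i != j -> b i j = 0 -> b j i = 0 ->
  act (alt 2 i j) = act (alt 2 j i).
Proof.
move=> ij bij bji; apply/funext => v; rewrite (put_id i j v) /=.
by rewrite !(refl_putl, refl_putr) // bij bji !mul0r !addr0.
Qed.

Lemma braid3 i j : i != j -> p i = p j -> b i j * b j i = p i ^+ 2 ->
  act (alt 3 i j) = act (alt 3 j i).
Proof.
move=> ij pij bb; apply/funext => v; rewrite (put_id i j v) /=.
rewrite !(refl_putl, refl_putr) // -pij.
congr put; ring: bb.
Qed.

Lemma braid4 i j : i != j -> b i j * b j i = p i ^+ 2 + p j ^+ 2 ->
  act (alt 4 i j) = act (alt 4 j i).
Proof.
move=> ij bb; apply/funext => v; rewrite (put_id i j v) /=.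
rewrite !(refl_putl, refl_putr) //.
congr put; ring: bb.
Qed.

Lemma braid6 i j : i != j -> b i j * b j i = p i ^+ 2 + p j ^+ 2 + p i * p j ->
  act (alt 6 i j) = act (alt 6 j i).
Proof.
move=> ij bb; apply/funext => v; rewrite (put_id i j v) /=.
rewrite !(refl_putl, refl_putr) //.
congr put; ring: bb.
Qed.

Lemma dihedral2 i j : i != j -> b i j = 0 -> b j i = 0 -> dihedral i j.
Proof.
move=> ij bij bji; right; exists 1%N; split; last exact: braid2.
by case=> [|[|//]] _ /=; rewrite ?bij ?bji ?mul0r ?subr0; split;
  first [exact: cone1 | exact: cone0].
Qed.

Lemma dihedral3 i j : i != j -> p i = p j -> b i j * b j i = p i ^+ 2 ->
  dihedral i j.
Proof.
move=> ij pij bb; right; exists 2%N; split; last exact: braid3.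
have c2 i' j' : b i' j' * b j' i' = p i' ^+ 2 -> cheb 2 i' j' = 0.
  by move=> e; rewrite /= ?mulr1 subr0 e subrr.
case=> [|[|[|//]]] _; first by split; exact: cone1.
  by rewrite /= !mulr1 !subr0; split.
by rewrite !c2 // ?[b j i * _]mulrC -?pij //; split; exact: cone0.
Qed.

Lemma dihedral4 i j : i != j -> b i j * b j i = p i ^+ 2 + p j ^+ 2 ->
  dihedral i j.
Proof.
move=> ij bb; right; exists 3%N; split; last exact: braid4.
have c2 i' j' : b i' j' * b j' i' = p i' ^+ 2 + p j' ^+ 2 ->
    P (cheb 2 i' j') /\ cheb 3 i' j' = 0.
  move=> e; rewrite [cheb 2 _ _](_ : _ = p j' ^+ 2) /=; last by ring: e.
  by split; [exact: p2_pos | ring: e].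
have [Pij cij] := c2 i j bb.
have [|Pji cji] := c2 j i; first by rewrite mulrC bb addrC.
case=> [|[|[|[|//]]]] _; first by split; exact: cone1.
- by rewrite /= !mulr1 !subr0; split.
- by split.
- by rewrite cij cji; split; exact: cone0.
Qed.

Lemma dihedral6 i j : i != j -> b i j * b j i = p i ^+ 2 + p j ^+ 2 + p i * p j ->
  dihedral i j.
Proof.
move=> ij bb; right; exists 5%N; split; last exact: braid6.
have c2 i' j' : b i' j' * b j' i' = p i' ^+ 2 + p j' ^+ 2 + p i' * p j' ->
    forall n, (n < 6)%N -> P (cheb n i' j').
  move=> e; case=> [|[|[|[|[|[|//]]]]]] _; first exact: cone1.
  - by rewrite /= mulr1 subr0.
  - rewrite [cheb _ _ _](_ : _ = p j' ^+ 2 + p i' * p j') /=; last by ring: e.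
    by apply: coneD => //; [exact: p2_pos | exact: coneM].
  - rewrite [cheb _ _ _](_ : _ = b i' j' * (p i' * p j')) /=; last by ring: e.
    by do 2!apply: coneM => //.
  - rewrite [cheb _ _ _](_ : _ = p i' * p j' * p j' ^+ 2) /=; last by ring: e.
    by do 2!apply: coneM => //; exact: p2_pos.
  - rewrite [cheb _ _ _](_ : _ = 0) /=; last by ring: e.
    exact: cone0.
move=> n n6; split; first exact: c2.
by apply: c2 => //; rewrite mulrC bb; ring.
Qed.

(* With W n defined by W 0 = 1, W 1 = s + s' + r and
   W (n+2) = W 1 * W (n+1) - s s' W n, cheb 2n+1 i j = b i j * W n and
   cheb 2n+2 i j = W (n+1) + p j ^+ 2 * W n; moreover W (n+1) - s W n >= 0. *)
Lemma dihedral_infinite i j (s s' r : S) : P s -> P s' -> P r ->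
  s * s' = p i ^+ 2 * p j ^+ 2 ->
  b i j * b j i = p i ^+ 2 + p j ^+ 2 + (s + s' + r) ->
  dihedral i j.
Proof.
move=> Ps Ps' Pr ss bb; left.
pose t := s + s' + r.
pose W := fix W n := match n with
  | 0 => 1 | n'.+1 => t * W n' - (if n' is n''.+1 then s * s' * W n'' else 0) end.
have W2 n : W n.+2 = t * W n.+1 - s * s' * W n by [].
have PW n : P (W n) /\ P (W n.+1 - s * W n).
  elim: n => [|n [Pn PSn]].
    split; first exact: cone1.
    by rewrite /= /t !mulr1 subr0 (_ : _ - _ = s' + r); [exact: coneD | ring].
  have PSn' : P (W n.+1).
    by rewrite -(subrK (s * W n) (W _)); apply: coneD => //; apply: coneM.
  split=> //; rewrite W2 (_ : _ - _ = s' * (W n.+1 - s * W n) + r * W n.+1).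
    by apply: coneD => //; apply: coneM.
  by rewrite /t; ring.
pose good_pair i' j' := b i' j' * b j' i' = p i' ^+ 2 + p j' ^+ 2 + t /\
  s * s' = p i' ^+ 2 * p j' ^+ 2.
have swap i' j' : good_pair i' j' -> good_pair j' i'.
  by move=> [e es]; split; [rewrite mulrC e; ring | rewrite es mulrC].
have c n i' j' : good_pair i' j' ->
    cheb n.*2.+1 i' j' = b i' j' * W n /\
    cheb n.*2.+2 i' j' = W n.+1 + p j' ^+ 2 * W n.
  elim: n i' j' => [|n IHn] i' j' eij; have [e es] := eij.
    by rewrite /=; split; ring: e.
  have [c1 c2] := IHn i' j' eij; have [c1' c2'] := IHn j' i' (swap _ _ eij).
  have c3 x y : cheb n.*2.+3 x y = b x y * cheb n.*2.+2 y x - p x ^+ 2 * cheb n.*2.+1 x y by [].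
  have c4 x y : cheb n.*2.+4 x y = b x y * cheb n.*2.+3 y x - p x ^+ 2 * cheb n.*2.+2 x y by [].
  rewrite doubleS; split; first by rewrite c3 c1 c2'; ring.
  by rewrite c4 c3 c1' c2 W2; ring: e es.
have P_cheb i' j' : good_pair i' j' -> forall n, P (cheb n i' j').
  move=> eij [|n]; first exact: cone1.
  have [c1 c2] := c n./2 i' j' eij; have [PW1 _] := PW n./2.
  rewrite -(odd_double_half n); case: (odd n); rewrite ?add1n ?add0n ?c1 ?c2.
    apply: coneD => //; first by case: (PW n./2.+1).
    by apply: coneM => //; exact: p2_pos.
  exact: coneM.
have ij_good : good_pair i j by [].
by move=> n; split; apply: P_cheb => //; apply: swap.
Qed.

Lemma refl_sum i (T : finType) (x : T -> S) (v : T -> J -> S) :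
  refl i (fun k => \sum_t x t * v t k) = fun k => \sum_t x t * refl i (v t) k.
Proof.
apply/funext => k; rewrite /refl; case: eqP => // _.
under [RHS]eq_bigr do rewrite mulrDr mulr_sumr.
rewrite big_split /= mulr_sumr exchange_big; congr (_ + _) => /=.
  by apply: eq_bigr => t _; ring.
by apply: eq_bigr => j _; rewrite mulr_sumr; apply: eq_bigr => t _; ring.
Qed.

Lemma act_expand w v : act w v = fun k => \sum_l v l * act w (simple l) k.
Proof.
elim: w => [|i w IHw] /=; last by rewrite IHw refl_sum.
apply/funext => k; rewrite (bigD1 k) //= /simple eqxx mulr1 big1 ?addr0 // => l.
by rewrite eq_sym => /negbTE ->; rewrite mulr0.
Qed.

End Reflections.

(** * The bipartite double cover *)

Lemma eqbN c : (c == ~~ c) = false. Proof. by case: c. Qed.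

Lemma eqNb c : (~~ c == c) = false. Proof. by case: c. Qed.

Section Cover.
Variables (S : comNzRingType) (P : S -> Prop) (n : nat).
Variables (p : 'I_n -> S) (b : 'I_n -> 'I_n -> S).

(** The cases are two orthogonal roots, A2, B2, G2 and the infinite dihedral group. At [q = mu = 1]
    the product [b i j * b j i] is 0, 1, 2, 3 and at least 4 respectively. *)
Inductive rank2_data i j : Prop :=
| Rank2Disjoint of b i j = 0 & b j i = 0
| Rank2A of p i = p j & b i j * b j i = p i ^+ 2
| Rank2B of b i j * b j i = p i ^+ 2 + p j ^+ 2
| Rank2G of b i j * b j i = p i ^+ 2 + p j ^+ 2 + p i * p j
| Rank2Infinite s s' r of P s & P s' & P r & s * s' = p i ^+ 2 * p j ^+ 2
    & b i j * b j i = p i ^+ 2 + p j ^+ 2 + (s + s' + r).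

Hypothesis P_cone : cone P.
Hypothesis p_pos : forall i, P (p i).
Hypothesis p_reg : forall i x, p i * x = 0 -> x = 0.
Hypothesis b_pos : forall i j, P (b i j).
Hypothesis b_diag : forall i, b i i = 0.
Hypothesis b_rank2 : forall i j, i != j -> rank2_data i j.

(* The Cartan datum of the bipartite double cover. *)
Let J : finType := ('I_n * bool)%type.
Let pc (x : J) := p x.1.
Let bc (x y : J) := if x.2 == y.2 then 0 else b x.1 y.1.
Local Notation act := (act pc bc).
Local Notation simple := (@simple S J).
Local Notation good := (good P pc bc).

Let bc_pos x y : P (bc x y).
Proof. by rewrite /bc; case: eqP => _; [exact: cone0 | exact: b_pos]. Qed.

Let pc_pos x : P (pc x). Proof. exact: p_pos. Qed.

Let pc_reg x y : pc x * y = 0 -> y = 0. Proof. exact: p_reg. Qed.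

(** Vertices of one colour, or over one index, are not joined; every other pair inherits the
    relation between its two indices. *)
Let cover_dihedral (x y : J) : x != y -> dihedral P pc bc x y.
Proof.
case: x y => [i c] [j c'] xy; have yx : (j, c') != (i, c) by rewrite eq_sym.
have [cc|cc] := eqVneq c c'.
  by apply: dihedral2 => //; rewrite /bc /= cc eqxx.
have [ij|ij] := eqVneq i j.
  by apply: dihedral2 => //; rewrite /bc /= ij b_diag if_same.
have bE : bc (i, c) (j, c') = b i j by rewrite /bc /= (negbTE cc).
have bE' : bc (j, c') (i, c) = b j i by rewrite /bc /= eq_sym (negbTE cc).
have [b1 b2|p1 b1|b1|b1|s s' r Ps Ps' Pr ss b1] := b_rank2 ij.
- by apply: dihedral2; rewrite ?bE ?bE'.
- by apply: dihedral3; rewrite ?bE ?bE'.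
- by apply: dihedral4; rewrite ?bE ?bE'.
- by apply: dihedral6; rewrite ?bE ?bE'.
- by apply: (dihedral_infinite P_cone pc_pos bc_pos Ps Ps' Pr); rewrite ?bE ?bE'.
Qed.

Definition fire (s : seq 'I_n) (c : bool) : seq J := [seq (i, c) | i <- s].

(** Vertices of one colour are not joined, so firing them one by one updates all of them
    simultaneously from the other colour. *)
Lemma act_fire s c v k x : uniq s -> act (fire s c) v (k, x) =
  if (x == c) && (k \in s)
  then - (p k ^+ 2) * v (k, c) + \sum_j b k j * v (j, ~~ c) else v (k, x).
Proof.
elim: s k x => [|i s IHs] k x /=; first by rewrite andbF.
case/andP=> i_s us; rewrite -/(fire s c) {1}/refl xpair_eqE inE.
rewrite andbC; have [xc|xc] /= := eqVneq x c; last by rewrite IHs // (negbTE xc).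
have [->|ki] := eqVneq k i; last by rewrite IHs // xc eqxx.
rewrite IHs // eqxx (negbTE i_s) /=; congr (_ + _).
rewrite (eq_bigr (fun y : J =>
  bc (i, c) (y.1, y.2) * act (fire s c) v (y.1, y.2))); last by case.
rewrite -(pair_big_dep (fun=> true) (fun j y => (j, y) != (i, c))
  (fun j y => bc (i, c) (j, y) * act (fire s c) v (j, y))) /=.
apply: eq_bigr => j _; rewrite (bigD1 (~~ c)) /=; last first.
  by rewrite xpair_eqE; case: (c); rewrite andbF.
rewrite IHs // eqNb /= {1}/bc /= eqbN big1 ?addr0 // => y /andP[_ yc].
have -> : y = c by case: (c) y yc => [] [].
by rewrite /bc eqxx mul0r.
Qed.

(** * Roots along the alternating firing of the two colours *)

Fixpoint word m : seq J :=
  if m is m'.+1 then word m' ++ fire (enum 'I_n) (odd m') else [::].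

(* Up to the factor p j, the coefficient of t ^ m.+1 in the (k, j) entry of
   the inverse of the deformed Cartan matrix. *)
Fixpoint invcoef m k j : S :=
  match m with
  | 0 => (k == j)%:R
  | m'.+1 => \sum_i invcoef m' k i * b i j -
      (if m' is m''.+1 then p j ^+ 2 * invcoef m'' k j else 0)
  end.

Lemma invcoefSS m k j : invcoef m.+2 k j =
  \sum_i invcoef m.+1 k i * b i j - p j ^+ 2 * invcoef m k j.
Proof. by []. Qed.

Lemma act_wordS m v k : act (word m.+1) v k =
  \sum_j (- (p j ^+ 2) * v (j, odd m) + \sum_i b j i * v (i, ~~ odd m))
    * act (word m) (simple (j, odd m)) k
  + \sum_j v (j, ~~ odd m) * act (word m) (simple (j, ~~ odd m)) k.
Proof.
rewrite /= act_cat act_expand.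
rewrite (eq_bigr (fun x : J => act (fire (enum 'I_n) (odd m)) v (x.1, x.2)
  * act (word m) (simple (x.1, x.2)) k)); last by case.
rewrite -(pair_bigA _ (fun j y => act (fire (enum 'I_n) (odd m)) v (j, y)
  * act (word m) (simple (j, y)) k)) /= -big_split.
apply: eq_bigr => j _; rewrite (bigD1 (odd m)) //= act_fire ?enum_uniq //.
rewrite eqxx mem_enum /=; congr (_ + _); rewrite (bigD1 (~~ odd m)) /=; last by case: odd.
rewrite big1 ?addr0 => [|y]; last by case: y; case: odd.
by rewrite act_fire ?enum_uniq //; case: odd.
Qed.

Lemma act_word_fired m j k :
  act (word m.+1) (simple (j, odd m)) k = - (p j ^+ 2) * act (word m) (simple (j, odd m)) k.
Proof.
rewrite act_wordS [X in _ + X]big1 ?addr0 => [|i _]; last first.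
  by rewrite !simpleE xpair_eqE ?eqbN ?eqNb andbF mul0r.
have s0 i : \sum_l b i l * simple (j, odd m) (l, ~~ odd m) = 0.
  by rewrite big1 // => l _; rewrite simpleE xpair_eqE eqNb andbF mulr0.
rewrite (bigD1 j) //= [X in _ + X]big1 ?addr0 => [|i ij].
  by rewrite s0 simpleE eqxx mulr1 addr0.
by rewrite s0 simpleE xpair_eqE (negbTE ij) mulr0 add0r mul0r.
Qed.

Lemma act_word_next m j k :
  act (word m.+1) (simple (j, ~~ odd m)) k =
  act (word m) (simple (j, ~~ odd m)) k
  + \sum_i act (word m) (simple (i, odd m)) k * b i j.
Proof.
rewrite act_wordS addrC; congr (_ + _).
  rewrite (bigD1 j) //= simpleE eqxx mul1r big1 ?addr0 // => i ij.
  by rewrite simpleE xpair_eqE (negbTE ij) mul0r.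
apply: eq_bigr => i _; rewrite simpleE xpair_eqE eqbN andbF mulr0 add0r.
rewrite (bigD1 j) //= simpleE eqxx mulr1 big1 ?addr0 1?mulrC // => l lj.
by rewrite simpleE xpair_eqE (negbTE lj) mulr0.
Qed.

(** By [act_word_next] a root is the preceding root of the same colour plus neighbours of the other
    colour. By [act_word_fired] the former is [- p j ^+ 2] times the root two stages earlier, which
    is the recursion of [invcoef]. *)
Lemma invcoefE m k j : act (word m) (simple (j, odd m)) (k, false) = invcoef m k j.
Proof.
elim/ltn_ind: m j => [[|m]] IH j; first by rewrite /= !simpleE xpair_eqE andbT.
rewrite [odd m.+1]/= act_word_next; under eq_bigr do rewrite IH //.
case: m IH => [|m] IH; first by rewrite /= !simpleE xpair_eqE andbF add0r subr0.
rewrite invcoefSS addrC; congr (_ + _).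
by rewrite [odd m.+1]/= negbK act_word_fired IH // mulNr.
Qed.

(** * Exclusion of negative roots by growth *)

Section Growth.
Variables (R : realDomainType) (eps : {rmorphism S -> R}).
Hypothesis eps_pos : forall x, P x -> 0 <= eps x.
Hypothesis eps_p : forall i, eps (p i) = 1.

Let a : 'M[R]_n := \matrix_(i, j) eps (b i j).
Let V m : 'M[R]_n := \matrix_(i, j) eps (invcoef m i j).

Hypothesis growth : forall j, exists u : 'rV[R]_n,
  [/\ forall i, 0 <= u 0 i, 0 < u 0 j & forall i, 2 * u 0 i <= (u *m a) 0 i].

Let V0 : V 0 = 1%:M.
Proof. by apply/matrixP => i j; rewrite !mxE rmorph_nat. Qed.

Let V1 : V 1 = a.
Proof.
apply/matrixP => i j; rewrite !mxE /= subr0 rmorph_sum (bigD1 i) //= eqxx mul1r.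
by rewrite big1 ?addr0 // => k; rewrite eq_sym => /negbTE ->; rewrite mul0r rmorph0.
Qed.

Let VSS m : V m.+2 = V m.+1 *m a - V m.
Proof.
apply/matrixP => i j; rewrite !mxE invcoefSS rmorphB rmorphM rmorphXn eps_p.
rewrite expr1n mul1r rmorph_sum; congr (_ - _).
by apply: eq_bigr => k _; rewrite rmorphM !mxE.
Qed.

Let Va m : V m *m a = a *m V m.
Proof.
elim/ltn_ind: m => [[|[|m]]] IH; first by rewrite V0 mul1mx mulmx1.
  by rewrite V1.
by rewrite VSS mulmxBl mulmxBr mulmxA -!IH.
Qed.

(** Since [V m] commutes with [a], the second difference of [u *m V m] is [u *m (a - 2) *m V m.+1],
    which is non-negative when [V m.+1] is. Positivity up to [m] therefore controls [V m.+1], the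
    first matrix whose sign is still open. *)
Lemma invcoef_growth m j (u : 'rV[R]_n) :
  (forall i, 0 <= u 0 i) -> (forall i, 2 * u 0 i <= (u *m a) 0 i) ->
  (forall m', (m' <= m)%N -> forall i k, P (invcoef m' i k)) ->
  u 0 j <= (u *m V m) 0 j /\ u 0 j <= (u *m V m.+1) 0 j - (u *m V m) 0 j.
Proof.
move=> u0 ua; elim: m => [|m IHm] Pm.
  by rewrite V0 V1 mulmx1 lexx lerBrDr -mulr2n -mulr_natl.
have [|h1 h2] := IHm; first by move=> m' mm'; apply: Pm; apply: ltnW.
split; first by have := u0 j; lra.
have : 2 * (u *m V m.+1) 0 j <= (u *m a *m V m.+1) 0 j.
  rewrite !mxE mulr_sumr; apply: ler_sum => i _; rewrite mulrA ler_wpM2r //.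
  by rewrite mxE; apply: eps_pos; apply: Pm.
have subE (x y : 'rV[R]_n) : (x - y) 0 j = x 0 j - y 0 j by rewrite !mxE.
rewrite -mulmxA -Va VSS mulmxBr subE.
by move: h1 h2; lra.
Qed.

(** Goodness of the word and positivity of the next layer of roots are proved together: the layer
    permits the next firing, and the longer word gives the dichotomy for the layer after it. *)
Lemma word_good m : good (word m) /\ forall j, pos P (act (word m) (simple (j, odd m))).
Proof.
elim/ltn_ind: m => [[|m]] IH.
  split; first exact: Good0.
  by move=> j k; rewrite /= !simpleE; case: eqP => _; [exact: cone1 | exact: cone0].
have [gm pm] := IH m (leqnn _).
have gm1 : good (word m.+1).
  rewrite /=; have := enum_uniq 'I_n; elim/last_ind: (enum _) => [|s i IHs].
    by rewrite cats0.
  rewrite rcons_uniq => /andP[i_s us].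
  rewrite /fire map_rcons -rcons_cat; apply: GoodS; first exact: IHs.
  (* Letters of the same colour fired before [i] leave its simple root unchanged. *)
  rewrite act_cat [act (map _ _) _](_ : _ = simple (i, odd m)) //.
  apply/funext => -[k x]; rewrite -/(fire s (odd m)) act_fire //.
  case: ifP => // /andP[/eqP -> ks].
  have /negbTE ki : k != i by apply: contraNneq i_s => <-.
  rewrite !simpleE !xpair_eqE ki mulr0 add0r big1 // => l _.
  by rewrite simpleE xpair_eqE eqNb andbF mulr0.
split=> // j.
have [//|[nj _]] :=
  good_dichotomy P_cone pc_pos pc_reg cover_dihedral (j, odd m.+1) gm1.
exfalso; have [u [u0 uj ua]] := growth j.
have [|h1 h2] := @invcoef_growth m j u u0 ua.
  by move=> m' mm' i k; rewrite -invcoefE; apply: (IH m' mm').2.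
(* A negative root would make column [j] of [V m.+1] non-positive, against the growth bound. *)
have : (u *m V m.+1) 0 j <= 0.
  rewrite mxE; apply: sumr_le0 => k _; rewrite mxE mulr_ge0_le0 //.
  rewrite -oppr_ge0 -rmorphN; apply: eps_pos.
  by rewrite -invcoefE; apply: nj.
by move: h1 h2 uj; lra.
Qed.

Lemma invcoef_pos m k j : P (invcoef m k j).
Proof. by rewrite -invcoefE; apply: (word_good m).2. Qed.
End Growth.
End Cover.

(** * Subharmonic vectors in infinite type *)

(** Induction by Schur complements: eliminating a positive first diagonal entry keeps the matrix
    symmetric with non-positive off-diagonal entries. If that entry is non-positive, the first basis
    vector is a witness. *)
Lemma posdef_or_subharmonic (R : realFieldType) n (M : 'M[R]_n) :
  M^T = M -> (forall i j, i != j -> M i j <= 0) ->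
  (forall x : 'cV[R]_n, x != 0 -> 0 < (x^T *m M *m x) 0 0) \/
  exists u : 'cV[R]_n,
    [/\ u != 0, forall i, 0 <= u i 0 & forall i, (M *m u) i 0 <= 0].
Proof.
elim: n M => [|n IHn] M.
  by left=> x; rewrite (flatmx0 x) eqxx.
rewrite -[n.+1]/(1 + n)%N in M * => Ms M_le0.
pose a := M 0 0; pose v := ursubmx M; pose N := drsubmx M.
have ME : M = block_mx a%:M v v^T N.
  rewrite -[LHS]submxK; congr block_mx; first by rewrite [LHS]mx11_scalar !mxE lshift0.
  by rewrite /v trmx_ursub Ms.
have v_le0 j : v 0 j <= 0 by rewrite !mxE; apply: M_le0.
have [a_le0|a_gt0] := lerP a 0.
  right; exists (col_mx 1%:M 0); split.
  - by rewrite col_mx_eq0 oner_eq0.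
  - by move=> i; rewrite mxE; case: splitP => j _; rewrite !mxE ?ler0n.
  - move=> i; rewrite ME mul_block_col !mulmx0 !addr0 !mulmx1 mxE.
    case: splitP => j _; first by rewrite (ord1 j) mxE eqxx mulr1n.
    by rewrite mxE v_le0.
have a0 : a != 0 by rewrite gt_eqF.
pose N' := N - a^-1 *: (v^T *m v).
have N's : N'^T = N'.
  rewrite /N' linearB linearZ /= trmx_mul trmxK; congr (_ - _).
  by rewrite /N trmx_drsub Ms.
have N'_le0 i j : i != j -> N' i j <= 0.
  move=> ij; have -> : N' i j = N i j - a^-1 * (v 0 i * v 0 j).
    by rewrite !mxE big_ord1 !mxE.
  rewrite subr_le0 (@le_trans _ _ 0) //.
    by rewrite !mxE; apply: M_le0; rewrite (inj_eq (@rshift_inj _ _)).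
  by rewrite mulr_ge0 ?invr_ge0 ?(ltW a_gt0) // mulr_le0.
have [pos|[u [u0 u_ge0 Nu]]] := IHn N' N's N'_le0; [left=> x x0 | right].
  pose y := dsubmx x; pose s := x 0 0; pose w := (v *m y) 0 0.
  have xE : x = col_mx s%:M y.
    by rewrite -[LHS]vsubmxK [usubmx x]mx11_scalar !mxE lshift0.
  (* Completing the square in the first coordinate. *)
  have -> : (x^T *m M *m x) 0 0 = a * (s + a^-1 * w) ^+ 2 + (y^T *m N' *m y) 0 0.
    have vy : v *m y = w%:M by exact: mx11_scalar.
    have yv : y^T *m v^T = w%:M by rewrite -trmx_mul vy tr_scalar_mx.
    have -> : y^T *m N' *m y = y^T *m N *m y - a^-1 *: (w%:M *m w%:M).
      rewrite mulmxBr mulmxBl -scalemxAr -scalemxAl; congr (_ - _ *: _).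
      by rewrite mulmxA yv -mulmxA vy.
    rewrite xE ME tr_col_mx tr_scalar_mx mul_row_block mul_row_col yv mulmxDl.
    rewrite [in X in _ + X]mulmxDl -[s%:M *m v *m y]mulmxA vy -!scalar_mxM -scalemx1.
    move: (y^T *m N *m y) => z; rewrite scalemx1 !mxE !eqxx !mulr1n; field.
    exact: a0.
  have [y0|y0] := eqVneq y 0.
    have s0 : s != 0 by apply: contraNneq x0 => s0; rewrite xE y0 s0 raddf0 col_mx0.
    rewrite /w y0 !mulmx0 mxE mulr0 !addr0 mulr_gt0 // exprn_even_gt0 //.
  by rewrite ltr_wpDl ?pos // mulr_ge0 ?(ltW a_gt0) // sqr_ge0.
(* The first coordinate is chosen to annihilate the first row of [M *m u]; it is non-negative
   because [v] is non-positive. *)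
exists (col_mx (- a^-1 *: (v *m u)) u); split.
- by rewrite col_mx_eq0 negb_and u0 orbT.
- move=> i; rewrite mxE; case: splitP => j _ //; rewrite !mxE mulNr oppr_ge0.
  rewrite mulr_ge0_le0 ?invr_ge0 ?(ltW a_gt0) //; apply: sumr_le0 => k _.
  by rewrite mulr_le0_ge0 // (ord1 j).
- have e : M *m col_mx (- a^-1 *: (v *m u)) u = col_mx 0 (N' *m u).
    rewrite ME mul_block_col -!scalemxAr mul_scalar_mx scalerA mulNr mulVf //.
    rewrite scaleN1r addNr mulmxBl -scalemxAl mulmxA scaleNr addrC.
    by [].
  by move=> i; rewrite e mxE; case: splitP => j _; [rewrite mxE | exact: Nu].
Qed.

(** As [a] is non-negative, [u *m a] satisfies the same inequality, and it is positive at [j] as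
    soon as [u] is positive at a neighbour [i]. Iterating along a path reaches any vertex. *)
Lemma subharmonic_connect (R : realDomainType) n (a : 'M[R]_n) (e : rel 'I_n) :
  (forall i j, 0 <= a i j) -> (forall i j, e i j -> 0 < a i j) ->
  (forall i j, connect e i j) ->
  (exists u : 'rV[R]_n,
    [/\ u != 0, forall i, 0 <= u 0 i & forall i, 2 * u 0 i <= (u *m a) 0 i]) ->
  forall j, exists u : 'rV[R]_n,
    [/\ forall i, 0 <= u 0 i, 0 < u 0 j & forall i, 2 * u 0 i <= (u *m a) 0 i].
Proof.
move=> a0 ea conn [u [un0 u0 ua]] j.
have [i ui] : exists i, 0 < u 0 i.
  apply: contrapT => nu; case/eqP: un0; apply/rowP => i; rewrite mxE.
  apply/eqP; rewrite eq_le u0 andbT leNgt; apply/negP => ui.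
  by apply: nu; exists i.
have /connectP[s es ->] := conn i j; clear j.
elim: s i u un0 u0 ua ui es => [|j s IHs] i u un0 u0 ua ui /=; first by exists u.
case/andP=> eij es.
have ua0 k : 0 <= (u *m a) 0 k.
  by rewrite mxE; apply: sumr_ge0 => l _; rewrite mulr_ge0.
have uaj : 0 < (u *m a) 0 j.
  rewrite mxE (bigD1 i) //= ltr_pwDl ?mulr_gt0 ?ea //.
  by apply: sumr_ge0 => l _; rewrite mulr_ge0.
apply: (IHs j (u *m a)) => //.
  by apply/eqP => ua_0; move: uaj; rewrite ua_0 mxE ltxx.
move=> k; rewrite mxE [leRHS]mxE mulr_sumr; apply: ler_sum => l _.
by rewrite mulrA ler_wpM2r.
Qed.

(** * Positivity and augmentation in group rings *)

Section Augmentation.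
Variables (G : zmodType) (R : realDomainType).
Implicit Types f : grpring G.

Definition nonneg f : Prop := forall x, 0 <= f@_x.

Lemma nonneg_gelt (x : G) : nonneg (gelt x).
Proof. by move=> y; rewrite mcoeffU ler0n. Qed.

Lemma nonneg_sum (I : Type) (r : seq I) (F : I -> grpring G) :
  (forall i, nonneg (F i)) -> nonneg (\sum_(i <- r) F i).
Proof. by move=> F0 x; rewrite raddf_sum; apply: sumr_ge0 => i _; apply: F0. Qed.

Lemma nonneg_cone : cone nonneg.
Proof.
split.
- exact: nonneg_gelt.
- by move=> f g f0 g0 x; rewrite mcoeffD addr_ge0.
- move=> f g f0 g0; rewrite -[f * g]/(gmul f g) /gmul.
  apply: nonneg_sum => x; apply: nonneg_sum => y z.
  by rewrite mcoeffU mulrn_wge0 // mulr_ge0.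
- move=> f f0 nf; apply/malgP => x; rewrite mcoeff0; apply/eqP.
  by rewrite eq_le f0 -oppr_ge0 -mcoeffN nf.
- by move=> x; rewrite mcoeff0.
Qed.

(** The specialisation at [q = mu = 1], with values in [R] so that it can be paired with the real
    vectors of [growth]. *)
Definition aug f : R := \sum_(x <- msupp f) (f@_x)%:~R.

Lemma augw (D : {fset G}) f : fsubset (msupp f) D -> aug f = \sum_(x <- D) (f@_x)%:~R.
Proof.
by move=> le; apply: (big_fset_incl _ le) => x _ /mcoeff_outdom ->.
Qed.

Lemma augU (c : int) (x : G) : aug << c *g x >> = c%:~R.
Proof. by rewrite (@augw [fset x]%fset) ?msuppU_le // big_seq_fset1 mcoeffUU. Qed.

Fact aug_zmod_morphism : zmod_morphism aug.
Proof.
move=> f g; set D := (msupp f `|` msupp g)%fset.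
rewrite (@augw D) ?msuppB_le // (@augw D f) ?fsubsetUl // (@augw D g) ?fsubsetUr //.
by rewrite -sumrB; apply: eq_bigr => x _; rewrite mcoeffB rmorphB.
Qed.

HB.instance Definition _ := GRing.isZmodMorphism.Build (grpring G) R aug aug_zmod_morphism.

Fact aug_monoid_morphism : monoid_morphism aug.
Proof.
split=> [|f g]; first exact: augU.
rewrite -[f * g]/(gmul f g) /gmul raddf_sum mulr_suml; apply: eq_bigr => x _.
rewrite raddf_sum mulr_sumr; apply: eq_bigr => y _.
by rewrite [LHS]augU rmorphM.
Qed.

HB.instance Definition _ :=
  GRing.isMonoidMorphism.Build (grpring G) R aug aug_monoid_morphism.

Lemma aug_ge0 f : nonneg f -> 0 <= aug f.
Proof. by move=> f0; apply: sumr_ge0 => x _; rewrite ler0z. Qed.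

Lemma aug_gelt (x : G) : aug (gelt x) = 1.
Proof. exact: augU. Qed.

Lemma aug_qint (x : G) k : aug (qint x k) = k%:R.
Proof.
rewrite raddf_sum (eq_bigr (fun=> 1)) => [|i _]; last exact: aug_gelt.
by rewrite sumr_const card_ord.
Qed.

End Augmentation.

(** * The inverse of the deformed Cartan matrix *)

Section Inverse.
Variables (n : nat) (C : 'M[int]_n) (d : 'I_n -> nat).
Local Notation S := (grpring (Gamma0 C)).

Definition qdeg (z : int) : S := gelt (gamma_q C *~ z).

Lemma qdegD y z : qdeg (y + z) = qdeg y * qdeg z.
Proof. by rewrite /qdeg mulrzDr geltD. Qed.

Lemma nonneg_qdeg z : nonneg (qdeg z).
Proof. exact: nonneg_gelt. Qed.

Definition pwt i : S := qdeg (- (d i)%:Z).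

Lemma qdeg_pwt i : qdeg (d i)%:Z * pwt i = 1.
Proof. by rewrite /pwt -qdegD subrr. Qed.

Lemma pwt_reg i x : pwt i * x = 0 -> x = 0.
Proof.
have := qdeg_pwt i; move: (qdeg _) (pwt i) => y z yz zx.
by rewrite -[x]mul1r -yz -mulrA zx mulr0.
Qed.

Definition edge_wt i j : S := if (i != j) && adj C i j then
  qint (gamma_q C *+ d i) (edge_f C i j) * \sum_(g < edge_gcd C i j) gelt (gamma_mu g)
  else 0.

Definition cartan_wt i j : S := pwt i * edge_wt i j.

(** The index is shifted by one: the diagonal of the deformed matrix starts at [t ^ -1], so its
    inverse starts at [t]. *)
Definition inv_fun k j (m : int) : S :=
  if m is Posz m'.+1 then pwt j * invcoef pwt cartan_wt m' k j else 0.

Fact inv_bounded k j : inv_fun k j \in @bounded_below S.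
Proof. by apply/asboolP; exists 0 => -[]. Qed.

Definition inv_mx : 'M[laurent S]_n := \matrix_(k, j) Laurent (inv_bounded k j).

(** The diagonal is written with [d j], so that in a matrix product its factor depends on the column
    only. *)
Lemma dgcmE i j : dgcm C d i j =
  (if i == j then lmon (qdeg (d j)) (-1) + lmon (pwt j) 1 else 0) - lmon (edge_wt i j) 0.
Proof.
have lmon0 : lmon (0 : S) 0 = 0.
  by apply: laurentP => k /=; rewrite /lmon_fun; case: eqP.
rewrite mxE /edge_wt; case: eqP => [->|] /=; first by rewrite lmon0 subr0 /pwt /qdeg mulrNz.
by case: ifP => _ _; rewrite ?lmon0 ?subr0 ?sub0r.
Qed.

(** By invertibility a left inverse suffices. Comparing coefficients of [t ^ m] gives the recursion
    of [invcoef] for positive [m], and the identity matrix at [m = 0]. *)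
Lemma invmx_dgcm : invmx (dgcm C d) = inv_mx.
Proof.
suff e : inv_mx *m dgcm C d = 1%:M.
  by rewrite -[RHS](mulmxK (dgcm_unit C d)) e mul1mx.
apply/matrixP => k j; rewrite mxE.
pose Y i : laurent S := inv_mx k i.
have coef i m : (Y i * dgcm C d i j) m =
    (if i == j then qdeg (d j) * Y j (m + 1) + pwt j * Y j (m - 1) else 0)
      - edge_wt i j * Y i m.
  rewrite mulrC dgcmE mulrBl lcoefD.
  have -> : (- (lmon (edge_wt i j) 0 * Y i)) m = - (edge_wt i j * Y i m).
    by rewrite -[LHS]/(- ((lmon (edge_wt i j) 0 * Y i) m)) [X in - X]lmul_lmon subr0.
  congr (_ - _); case: eqP => [->|_]; last by rewrite mul0r.
  by rewrite mulrDl lcoefD [X in X + _]lmul_lmon [X in _ + X]lmul_lmon opprK.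
apply: laurentP => m; rewrite lcoef_sum.
rewrite (eq_bigr (fun i =>
    (if i == j then qdeg (d j) * Y j (m + 1) + pwt j * Y j (m - 1) else 0)
      - edge_wt i j * Y i m)); last by move=> i _; exact: coef.
rewrite sumrB -big_mkcond big_pred1_eq /=.
have YE i m' : Y i m' = inv_fun k i m' by rewrite /Y mxE.
under eq_bigr do rewrite YE.
have -> : (1%:M : 'M[laurent S]_n) k j m = ((k == j) && (m == 0))%:R.
  by rewrite mxE mulrb; case: eqP => _ //; rewrite lcoef1.
rewrite !YE; clear Y coef YE.
have qpK x : qdeg (d j) * (pwt j * x) = x by rewrite mulrA qdeg_pwt mul1r.
move: (qdeg (d j)) qpK => qj qpK.
have inv_funS i m' : inv_fun k i m'.+1%:Z = pwt i * invcoef pwt cartan_wt m' k i.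
  by [].
have inv_fun_le0 i m' : m' <= 0 -> inv_fun k i m' = 0 by case: m' => [[]|].
(* The factor [pwt i] of column [i] of the candidate inverse turns [edge_wt i j] into
   [cartan_wt i j]. *)
have mesh m' : qj * (pwt j * invcoef pwt cartan_wt m'.+1 k j)
    + pwt j * inv_fun k j m' = \sum_i edge_wt i j * inv_fun k i m'.+1%:Z.
  have -> : \sum_i edge_wt i j * inv_fun k i m'.+1%:Z =
      \sum_i invcoef pwt cartan_wt m' k i * cartan_wt i j.
    apply: eq_bigr => i _.
    by rewrite inv_funS mulrC -mulrA [RHS]mulrCA.
  rewrite qpK; case: m' => [|m'].
    by rewrite inv_fun_le0 // mulr0 addr0 [invcoef _ _ 1 _ _]/= subr0.
  by rewrite inv_funS invcoefSS; ring.
have [m0|m0] := ltP 0 m.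
  have [m' ->] : exists m', m = m'.+1%:Z by exists (absz m).-1; lia.
  rewrite andbF -mesh.
  have -> : m'.+1%:Z + 1 = m'.+2%:Z by lia.
  have -> : m'.+1%:Z - 1 = m'%:Z by lia.
  by rewrite inv_funS subrr.
rewrite [X in _ - X]big1 ?subr0 => [|i _]; last by rewrite inv_fun_le0 ?mulr0.
have -> : pwt j * inv_fun k j (m - 1) = 0 by rewrite inv_fun_le0 ?mulr0 //; lia.
rewrite addr0.
have [->|mn0] := eqVneq m 0.
  by rewrite add0r (inv_funS j 0%N) qpK andbT.
by rewrite inv_fun_le0 ?mulr0 ?andbF //; lia.
Qed.

End Inverse.

(** * Rank two *)

Lemma sum_ends2 (V : nmodType) (F : nat -> V) m :
  \sum_(r < m.+2) F r = F 0%N + F m.+1 + \sum_(r < m) F r.+1.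
Proof.
rewrite -(big_mkord xpredT F) -(big_mkord xpredT (F \o succn)) big_nat_recl //.
by rewrite big_nat_recr //= [X in _ + X]addrC addrA.
Qed.

Lemma sum_ends4 (V : nmodType) (F : nat -> V) m :
  \sum_(r < m.+4) F r =
  F 0%N + F m.+3 + (F 1%N + F m.+2 + \sum_(r < m) F r.+2).
Proof. by rewrite sum_ends2 (sum_ends2 (F \o succn)). Qed.

Section QuantumProduct.
Variables (S : comNzRingType) (P : S -> Prop) (Q : int -> S).
Hypotheses (P_cone : cone P) (Q_pos : forall z, P (Q z)).
Hypothesis QD : forall y z, Q (y + z) = Q y * Q z.

(** The cases correspond to products of quantum integers with 1, 2, 3 and at least 4 terms. *)
Inductive quantum_product_spec (x y : S) : S -> Prop :=
| QuantumProduct1 of x = y : quantum_product_spec x y (x ^+ 2)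
| QuantumProduct2 : quantum_product_spec x y (x ^+ 2 + y ^+ 2)
| QuantumProduct3 : quantum_product_spec x y (x ^+ 2 + y ^+ 2 + x * y)
| QuantumProduct4 s s' r of P s & P s' & P r & s * s' = x ^+ 2 * y ^+ 2 :
    quantum_product_spec x y (x ^+ 2 + y ^+ 2 + (s + s' + r)).

(* The sum is v^(-a-b) [f]_(v^a) [h]_(v^b), expanded into powers of v. *)
Lemma quantum_productP (a b f h : nat) : (0 < f)%N -> (0 < h)%N ->
  (a * f = b * h)%N ->
  quantum_product_spec (Q (- a%:Z)) (Q (- b%:Z))
    (\sum_(r < f) \sum_(s < h)
       Q (a%:Z * (f%:Z - 2 - r.*2%:Z) + b%:Z * (h%:Z - 2 - s.*2%:Z))).
Proof.
case: f => // f; case: h => // h _ _ abfh.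
pose N r s := Q (a%:Z * (f.+1%:Z - 2 - r.*2%:Z) + b%:Z * (h.+1%:Z - 2 - s.*2%:Z)).
rewrite -[X in quantum_product_spec _ _ X]/(\sum_(r < f.+1) \sum_(s < h.+1) N r s).
(* By [a * f = b * h], two opposite corners of the grid of terms are the squares of the weights. *)
have Nx : N 0%N h = Q (- a%:Z) ^+ 2 by rewrite expr2 -QD; congr Q; lia.
have Ny : N f 0%N = Q (- b%:Z) ^+ 2 by rewrite expr2 -QD; congr Q; lia.
(* Terms symmetric about the centre of the grid have a constant product; such a pair provides the
   [s] and [s'] of the infinite case. *)
have Nopp r s r' s' : (r + r' = f)%N -> (s + s' = h)%N ->
    N r s * N r' s' = Q (- a%:Z) ^+ 2 * Q (- b%:Z) ^+ 2.
  by move=> rf sh; rewrite !expr2 -!QD; congr Q; nia.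
have Nx3 : (f = 2)%N -> h = 0%N -> N 1%N 0%N = Q (- a%:Z) * Q (- b%:Z).
  by move=> f2 h0; rewrite -QD; congr Q; lia.
have Ny3 : f = 0%N -> (h = 2)%N -> N 0%N 1%N = Q (- a%:Z) * Q (- b%:Z).
  by move=> f0 h2; rewrite -QD; congr Q; lia.
have xy : f = 0%N -> h = 0%N -> Q (- a%:Z) = Q (- b%:Z).
  by move=> f0 h0; congr Q; lia.
have N0 r s : P (N r s) by exact: Q_pos.
move: N (Q (- a%:Z)) (Q (- b%:Z)) Nx Ny Nopp Nx3 Ny3 xy N0.
move=> N x y Nx Ny Nopp Nx3 Ny3 xy N0.
have sumN0 m (F G : nat -> nat) : P (\sum_(k < m) N (F k) (G k)).
  by elim/big_ind: _ => [|u v|k _]; [exact: cone0 | exact: coneD | exact: N0].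
have sum0 m (F : nat -> S) : (forall k, P (F k)) -> P (\sum_(k < m) F k).
  by move=> F0; elim/big_ind: _ => [|u v|k _]; [exact: cone0 | exact: coneD | exact: F0].
case: h abfh Nx Nopp Nx3 Ny3 xy => [|h] abfh Nx Nopp Nx3 Ny3 xy.
  under eq_bigr do rewrite big_ord1.
  case: f abfh Nx Ny Nopp Nx3 Ny3 xy => [|[|[|f]]] abfh Nx Ny Nopp Nx3 Ny3 xy.
  - by rewrite big_ord1 Nx; apply: QuantumProduct1; apply: xy.
  - by rewrite (sum_ends2 (N^~ 0%N)) big_ord0 addr0 Nx Ny; apply: QuantumProduct2.
  - by rewrite (sum_ends2 (N^~ 0%N)) big_ord1 Nx Ny Nx3 //; apply: QuantumProduct3.
  (* With a single column, the pair is formed by the second and the last but one terms. *)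
  - rewrite (sum_ends4 (N^~ 0%N)) Nx Ny; apply: QuantumProduct4 => //.
      exact: (sumN0 f (fun k => k.+2) (fun=> 0%N)).
    by apply: Nopp; rewrite ?addn0 // add1n.
case: f abfh Nx Ny Nopp Nx3 Ny3 xy => [|f] abfh Nx Ny Nopp Nx3 Ny3 xy.
  rewrite big_ord1; case: h abfh Nx Ny Nopp Nx3 Ny3 xy => [|[|h]] abfh Nx Ny Nopp Nx3 Ny3 xy.
  - by rewrite (sum_ends2 (N 0%N)) big_ord0 addr0 Nx Ny addrC; apply: QuantumProduct2.
  - rewrite (sum_ends2 (N 0%N)) big_ord1 Nx Ny Ny3 // [y ^+ 2 + _]addrC.
    exact: QuantumProduct3.
  - rewrite (sum_ends4 (N 0%N)) Nx Ny [y ^+ 2 + _]addrC; apply: QuantumProduct4 => //.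
      exact: (sumN0 h (fun=> 0%N) (fun k => k.+2)).
    by apply: Nopp; rewrite ?addn0 // add1n.
(* With at least two rows and columns, the pair is formed by the two remaining corners. *)
rewrite (sum_ends2 (fun r => \sum_(s < h.+2) N r s)).
rewrite (sum_ends2 (N 0%N)) (sum_ends2 (N f.+1)) Nx Ny.
set r0 := bigop _ _ _; set r1 := bigop _ _ _; set r2 := bigop _ _ _.
rewrite [X in quantum_product_spec _ _ X](_ : _ =
  x ^+ 2 + y ^+ 2 + (N 0%N 0%N + N f.+1 h.+1 + (r0 + r1 + r2))); last by ring.
apply: QuantumProduct4 => //; last by apply: Nopp.
apply: coneD => //; last first.
  apply: (sum0 f (fun r => \sum_(s < h.+2) N r.+1 s)) => r.
  exact: (sumN0 h.+2 (fun=> r.+1) id).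
apply: coneD => //; first exact: (sumN0 h (fun=> 0%N) succn).
exact: (sumN0 h (fun=> f.+1) succn).
Qed.

Variant inverse_product_spec : S -> Prop :=
| InverseProduct1 : inverse_product_spec 1
| InverseProduct2 y y' r of P y & P y' & P r & y * y' = 1 :
    inverse_product_spec (2 + (y + y' + r)).

(** With several terms, the first and last diagonal products give 2, and the two cross products of
    first and last terms are inverse to each other. *)
Lemma inverse_productP (F F' : nat -> S) g : (0 < g)%N ->
  (forall k, P (F k)) -> (forall k, P (F' k)) ->
  (forall k, (k < g)%N -> F k * F' k = 1) ->
  inverse_product_spec ((\sum_(k < g) F k) * (\sum_(k < g) F' k)).
Proof.
case: g => [//|[|g]] _ F0 F'0 FF.
  by rewrite !big_ord1 FF //; apply: InverseProduct1.
have sum0 (E : nat -> S) : (forall k, P (E k)) -> P (\sum_(k < g) E k.+1).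
  by move=> E0; elim/big_ind: _ => [|u v|k _]; [exact: cone0 | exact: coneD | exact: E0].
have FF0 : F 0%N * F' 0%N = 1 by exact: FF.
have FF1 : F g.+1 * F' g.+1 = 1 by exact: FF.
rewrite !sum_ends2; set s := bigop _ _ _; set s' := bigop _ _ _.
have Ps : P s by exact: sum0.
have Ps' : P s' by exact: sum0.
rewrite [X in inverse_product_spec X](_ : _ = 2 + (F 0%N * F' g.+1 + F g.+1 * F' 0%N +
  ((F 0%N + F g.+1) * s' + s * (F' 0%N + F' g.+1 + s')))); last by ring: FF0 FF1.
apply: InverseProduct2; try by apply: coneM.
  by do ?[apply: coneD => // | apply: coneM => //].
by ring: FF0 FF1.
Qed.

Lemma rank2_dataP n (p : 'I_n -> S) b i j x m :
  P (p i) -> P (p j) ->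
  quantum_product_spec (p i) (p j) x -> inverse_product_spec m ->
  b i j * b j i = x * m -> rank2_data P p b i j.
Proof.
move=> pi0 pj0 xP mP e.
have pp y z : P y -> P z -> P (y * z) by exact: coneM.
have pi2 : P (p i ^+ 2) by rewrite expr2; apply: pp.
have pj2 : P (p j ^+ 2) by rewrite expr2; apply: pp.
case: mP e => [|y y' r y0 y'0 r0 yy].
  rewrite mulr1; case: xP => [pij|||s s' r s0 s'0 r0 ss] e.
  - exact: Rank2A.
  - exact: Rank2B.
  - exact: Rank2G.
  - exact: Rank2Infinite ss e.
have P2 : P 2 by apply: coneD => //; exact: cone1.
have Pm : P (2 + (y + y' + r)) by do ?[apply: coneD => //].
(* The factor is at least 2: one copy of [p i ^+ 2 + p j ^+ 2] is the required part, and a second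
   copy supplies [s] and [s']. *)
have large z : P z ->
    b i j * b j i = (p i ^+ 2 + p j ^+ 2 + z) * (2 + (y + y' + r)) ->
    rank2_data P p b i j.
  move=> z0 e; apply: (@Rank2Infinite _ _ _ _ _ _ _ (p i ^+ 2) (p j ^+ 2)
    ((p i ^+ 2 + p j ^+ 2) * (y + y' + r) + z * (2 + (y + y' + r)))) => //.
    by do ?[apply: coneD => // | apply: pp => //].
  by rewrite e; ring.
case: xP => [pij|||s s' t s0 s'0 t0 _] e.
(* Here the two weights agree, so the doubled [p i ^+ 2] is the required part; [s] and [s'] come
   from the inverse pair [y], [y']. *)
- apply: (@Rank2Infinite _ _ _ _ _ _ _ (p i ^+ 2 * y) (p i ^+ 2 * y') (p i ^+ 2 * r));
    try exact: pp.
    by rewrite -pij; ring: yy.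
  by rewrite e -pij; ring.
- by apply: (large 0); [exact: cone0 | rewrite addr0].
- by apply: (large (p i * p j)) => //; apply: pp.
- by apply: (large (s + s' + t)) => //; do ?[apply: coneD => //].
Qed.

End QuantumProduct.


(** * Rank-two data of the deformed Cartan matrix *)

Section RankTwo.
Variables (n : nat) (C : 'M[int]_n) (d : 'I_n -> nat).
Hypotheses (C_gcm : gcm C) (d_symm : symmetrizer C d).
Local Notation S := (grpring (Gamma0 C)).
Local Notation pwt := (pwt C d).
Local Notation edge_wt := (edge_wt C d).
Local Notation cartan_wt := (cartan_wt C d).
Local Notation nonneg := (@nonneg (Gamma0 C)).
Let P_cone : cone nonneg := nonneg_cone (Gamma0 C).

Lemma symmetrizerE i j : (d i)%:Z * C i j = (d j)%:Z * C j i.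
Proof.
have [_ dCs] := d_symm; have := congr1 (fun M : 'M_n => M j i) dCs.
by rewrite mxE /dC mul_diag_mx !mxE.
Qed.

Lemma adj_sym i j : adj C i j -> adj C j i.
Proof.
rewrite /adj /= => Cij; have [_ Cle C0] := C_gcm.
have ij : i != j by apply/eqP => ij; case: C_gcm => C2 _ _; move: Cij; rewrite ij C2.
have Cji0 : C j i != 0 by apply: contraTneq Cij => /C0 ->; rewrite ltxx.
by rewrite lt_neqAle Cji0 Cle // eq_sym.
Qed.

Lemma edge_gcdC i j : edge_gcd C i j = edge_gcd C j i.
Proof.
rewrite /edge_gcd gcdnC; case: ifPn => [/adj_sym ->|ij] //.
by case: ifPn => // /adj_sym; rewrite (negbTE ij).
Qed.

Lemma edge_fM i j : adj C i j -> (edge_f C i j * edge_gcd C i j)%N = `|C i j|%N.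
Proof.
by move=> ij; rewrite /edge_f /edge_gcd ij divnK // dvdn_gcdl.
Qed.

Lemma edge_gcd_gt0 i j : adj C i j -> (0 < edge_gcd C i j)%N.
Proof.
by move=> ij; rewrite /edge_gcd ij gcdn_gt0; move: ij; rewrite /adj /=; lia.
Qed.

Lemma edge_f_gt0 i j : adj C i j -> (0 < edge_f C i j)%N.
Proof.
by move=> ij; have := edge_fM ij; move: ij; rewrite /adj /=; lia.
Qed.

Lemma symmetrizer_f i j : adj C i j ->
  (d i * edge_f C i j)%N = (d j * edge_f C j i)%N.
Proof.
move=> ij; have ji := adj_sym ij; apply/eqP.
rewrite -(eqn_pmul2r (edge_gcd_gt0 ij)) -!mulnA edge_fM // edge_gcdC edge_fM //.
by have := symmetrizerE i j; move: ij ji; rewrite /adj /=; nia.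
Qed.

Definition edge_mus i j : S := \sum_(g < edge_gcd C i j) gelt (gamma_mu g).

Lemma qint_gamma (k f : nat) :
  qint (gamma_q C *+ k) f = \sum_(r < f) qdeg C (k%:Z * (f%:Z - 1 - r.*2%:Z)).
Proof. by apply: eq_bigr => r _; rewrite /qdeg mulrzA. Qed.

Lemma cartan_wt_mul i j : i != j -> adj C i j -> exists2 x,
  quantum_product_spec nonneg (pwt i) (pwt j) x &
  cartan_wt i j * cartan_wt j i = x * (edge_mus i j * edge_mus j i).
Proof.
move=> ij aij; have ji : j != i by rewrite eq_sym.
exists (pwt i * pwt j *
    (qint (gamma_q C *+ d i) (edge_f C i j) * qint (gamma_q C *+ d j) (edge_f C j i))).
  rewrite !qint_gamma [X in quantum_product_spec _ _ _ (_ * X)]big_distrlr.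
  rewrite mulr_sumr [X in quantum_product_spec _ _ _ X](eq_bigr (fun r : 'I__ =>
     \sum_(s < edge_f C j i) qdeg C ((d i)%:Z * ((edge_f C i j)%:Z - 2 - r.*2%:Z)
       + (d j)%:Z * ((edge_f C j i)%:Z - 2 - s.*2%:Z)))).
    apply: (quantum_productP P_cone (nonneg_qdeg (C := C)) (@qdegD _ C)).
    - exact: edge_f_gt0.
    - exact: edge_f_gt0 (adj_sym aij).
    - exact: symmetrizer_f.
  move=> r _; rewrite [LHS]mulr_sumr; apply: eq_bigr => s _ /=.
  (* The factors [pwt i] and [pwt j] lower the exponents, which turns each [- 1] of the quantum
     integers into [- 2]. *)
  set e := (X in _ = qdeg C X).
  have -> : e = - (d i)%:Z - (d j)%:Z + ((d i)%:Z * ((edge_f C i j)%:Z - 1 - r.*2%:Z)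
      + (d j)%:Z * ((edge_f C j i)%:Z - 1 - s.*2%:Z)) by rewrite /e; ring.
  by rewrite 3!qdegD.
rewrite /cartan_wt /edge_wt ij ji aij (adj_sym aij) /= -!/(edge_mus _ _).
have mulE (x y z x' y' z' : S) :
  x * (y * z) * (x' * (y' * z')) = x * x' * (y * y') * (z * z') by ring.
exact: mulE.
Qed.

Lemma edge_musP i j : adj C i j ->
  inverse_product_spec nonneg (edge_mus i j * edge_mus j i).
Proof.
(* The two sums range over ordinals whose bounds are only provably equal; extending the terms by 0
   to all natural numbers puts them over a common range. *)
move=> ij; pose F i j (x : nat) : S :=
  if insub x is Some g then gelt (@gamma_mu n C i j g) else 0.
have sumF i' j' : edge_mus i' j' = \sum_(x < edge_gcd C i' j') F i' j' x.
  by apply: eq_bigr => x _; rewrite /F valK.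
have F0 i' j' x : nonneg (F i' j' x).
  by rewrite /F; case: insub => [g|]; [exact: nonneg_gelt | exact: (cone0 P_cone)].
rewrite !sumF -(edge_gcdC i j); apply: (inverse_productP P_cone) => [||| x xg] //.
  exact: edge_gcd_gt0.
have xg' : (x < edge_gcd C j i)%N by rewrite -edge_gcdC.
rewrite /F (insubT (fun y => y < _)%N xg) (insubT (fun y => y < _)%N xg').
by rewrite -geltD gamma_muN.
Qed.

Lemma cartan_rank2 i j : i != j -> rank2_data nonneg pwt cartan_wt i j.
Proof.
move=> ij; have [aij|aij] := boolP (adj C i j); last first.
  have /negbTE aji : ~~ adj C j i by apply: contra aij; exact: adj_sym.
  apply: Rank2Disjoint; rewrite /cartan_wt /edge_wt ?aji ?(negbTE aij) ?andbF;
    by rewrite mulr0.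
have [x xP e] := cartan_wt_mul ij aij.
by apply: (rank2_dataP P_cone _ _ xP (edge_musP aij) e); exact: nonneg_qdeg.
Qed.

End RankTwo.

(** * Non-negativity of the inverse in infinite type *)

Theorem theorem1p3 (R : realType) (n : nat) (C : 'M[int]_n) (d : 'I_n -> nat)
    (C_gcm : gcm C) (C_irr : gcm_irreducible C) (d_symm : symmetrizer C d)
    (C_infinite : ~ finite_type C d R) (i j : 'I_n) :
  nonneg_power_series (invmx (dgcm C d) i j).
Proof.
have [C2 Cle C0] := C_gcm; have [d_gt0 dCs] := d_symm.
have dC_sym a b : dC C d a b = dC C d b a by rewrite -[in LHS]dCs mxE.
pose P_cone := nonneg_cone (Gamma0 C).
have p_pos k : nonneg (pwt C d k) by exact: nonneg_qdeg.
have b_pos k l : nonneg (cartan_wt C d k l).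
  apply: (coneM P_cone) => //; rewrite /edge_wt; case: ifP => _; last exact: (cone0 P_cone).
  by apply: (coneM P_cone); apply: nonneg_sum => x; exact: nonneg_gelt.
have b_diag k : cartan_wt C d k k = 0 by rewrite /cartan_wt /edge_wt eqxx mulr0.
(* At [q = mu = 1] the matrix of weights becomes [2 - C]. *)
have aug_b k l : aug R (cartan_wt C d k l) = (if k == l then 2 else 0) - (C k l)%:~R.
  rewrite rmorphM /= aug_gelt mul1r /edge_wt.
  have [->|kl] := eqVneq k l; first by rewrite raddf0 C2 subrr.
  case: ifPn => /= [kl_adj|]; last first.
    move=> kl_adj; have -> : C k l = 0 by apply/eqP; rewrite eq_le Cle // leNgt.
    by rewrite raddf0 subrr.
  rewrite rmorphM /= aug_qint rmorph_sum (eq_bigr (fun=> 1)) => [|x _]; last exact: aug_gelt.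
  rewrite sumr_const card_ord -natrM edge_fM // sub0r -mulrNz.
  by have := Cle _ _ kl; rewrite pmulrn => Ckl; congr (_%:~R); lia.
have growth k : exists u : 'rV[R]_n, [/\ forall l, 0 <= u 0 l, 0 < u 0 k &
    forall l, 2 * u 0 l <= (u *m \matrix_(a, b) aug R (cartan_wt C d a b)) 0 l].
  apply: (@subharmonic_connect _ _ _ (adj C)) => //.
  - by move=> a b; rewrite mxE aug_ge0.
  - move=> a b ab; rewrite mxE aug_b; case: eqVneq => [e|_].
      by move: ab; rewrite e /adj /= C2.
    by rewrite sub0r oppr_gt0 ltrz0.
  have [||//|[u [u0 u_ge0 Mu]]] := @posdef_or_subharmonic R n (map_mx intr (dC C d)).
  - by apply/matrixP => a b; rewrite [LHS]mxE [LHS]mxE [RHS]mxE dC_sym.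
  - move=> a b ab; rewrite mxE /dC mul_diag_mx !mxE lerz0.
    by rewrite pmulr_rle0 ?Cle // ltz_nat.
  (* By symmetry of [D C], the inequality [D C u <= 0] says that the row [u^T D] times [C] is
     non-positive; its entries keep the signs of [u] because [D] is positive. *)
  exists (\row_l (u l 0 * (d l)%:R)); split.
  - apply: contraNneq u0 => /rowP e; apply/eqP/colP => l; have := e l; rewrite !mxE.
    by move/eqP; rewrite mulf_eq0 pnatr_eq0 eqn0Ngt d_gt0 orbF => /eqP.
  - by move=> l; rewrite mxE mulr_ge0 ?ler0n.
  move=> l; have := Mu l; rewrite !mxE.
  rewrite (eq_bigr (fun a => (u a 0 * (d a)%:R) * (C a l)%:~R)); last first.
    move=> a _; rewrite /dC mxE mul_diag_mx !mxE (symmetrizerE d_symm) rmorphM /=.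
    by rewrite -pmulrn; ring.
  move=> le0; rewrite (eq_bigr (fun a => (if a == l then 2 * (u a 0 * (d a)%:R) else 0)
      - (u a 0 * (d a)%:R) * (C a l)%:~R)); last first.
    by move=> a _; rewrite !mxE aug_b; case: eqP => _; ring.
  by rewrite sumrB -big_mkcond big_pred1_eq /=; lra.
have pos := invcoef_pos P_cone p_pos (@pwt_reg _ C d) b_pos b_diag
  (cartan_rank2 C_gcm d_symm) (eps := aug R) (@aug_ge0 _ R) (fun=> aug_gelt R _) growth.
rewrite invmx_dgcm; split=> [k k0|k x]; rewrite mxE /=.
  by case: k k0 => // -[].
case: k => [[|k]|k] /=; rewrite ?mcoeff0 //.
exact: (coneM P_cone).
Qed.
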